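(* Let $\alpha,\beta\in\mathbb{C}\setminus\{-1,-2,\ldots\}$ with $\Re\alpha+\Re\beta>-1$, and let $1\le p\le\infty$. There is a constant $C_{\alpha,\beta,p}$, depending only on $\alpha$, $\beta$ and $p$, such that for every $\varphi\in L^p(\mathbb{T})$ and every $z\in\mathbb{D}$, $$\|DP_{\alpha,\beta}[\varphi](z)\|\le C_{\alpha,\beta,p}\,\frac{|\alpha+1|+|\beta+1|+|\alpha z|+|\beta z|}{(1-|z|^2)^{1+\frac1p}}\,\|\varphi\|_{L^p(\mathbb{T})},$$ where $\frac1p=0$ if $p=\infty$.
   Context: $\mathbb{D}$ is the open unit disc in $\mathbb{C}$, $\mathbb{T}=\partial\mathbb{D}$, and $m$ is the arc-length measure on $\mathbb{T}$ normalized so that $m(\mathbb{T})=1$; $L^p(\mathbb{T})$ is taken with respect to $m$ (complex-valued functions). For $\alpha,\beta\in\mathbb{C}$ put $$u_{\alpha,\beta}(z)=\frac{(1-|z|^2)^{\alpha+\beta+1}}{(1-z)^{\alpha+1}(1-\overline z)^{\beta+1}},\qquad |z|<1,$$ with principal branches of the powers. For $\alpha,\beta\in\mathbb{C}\setminus\{-1,-2,\dots\}$ with $\Re\alpha+\Re\beta>-1$ put $$c_{\alpha,\beta}=\frac{\Gamma(\alpha+1)\Gamma(\beta+1)}{\Gamma(\alpha+\beta+1)},$$ and for $f\in L^1(\mathbb{T})$ define the $(\alpha,\beta)$-Poisson integral $$P_{\alpha,\beta}[f](z)=\int_{\mathbb{T}}c_{\alpha,\beta}\,u_{\alpha,\beta}(z\overline\zeta)f(\zeta)\,dm(\zeta),\qquad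 z\in\mathbb{D}.$$ For a complex-valued $C^1$ function $f$ on a domain in $\mathbb{C}$, $Df(z)$ is its (real-linear) derivative at $z$ and $\|Df(z)\|=\sup\{|Df(z)\zeta|:|\zeta|=1\}=|f_z(z)|+|f_{\overline z}(z)|$, where $f_z=\frac12(f_x-if_y)$ and $f_{\overline z}=\frac12(f_x+if_y)$. *)

(* Defs.v *)
From mathcomp Require Import all_boot all_order all_algebra.
From mathcomp Require Import all_classical all_reals all_analysis.

Set Implicit Arguments.
Unset Strict Implicit.
Unset Printing Implicit Defensive.

Import Order.TTheory GRing.Theory Num.Theory numFieldNormedType.Exports.
(* after Num.Theory, so that Re and Im are the R-valued projections *)
From mathcomp Require Import complex.

Local Open Scope classical_set_scope.
Local Open Scope ring_scope.
Local Open Scope complex_scope.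

Section complex_functions.
Context {R : realType}.
Implicit Types z w a : R[i].

(* The modulus as a real number; the library's [`|z|] is an element of R[i]. *)
Definition cabs z : R := ComplexField.Normc.normc z.

Definition cexp z : R[i] :=
  (expR (Re z) * cos (Im z)) +i* (expR (Re z) * sin (Im z)).

(* Principal argument, with values in ]-pi, pi]; Arg 0 = 0. *)
Definition Arg z : R :=
  if 0 < Re z then atan (Im z / Re z)
  else if Re z < 0 then
    if 0 <= Im z then atan (Im z / Re z) + pi else atan (Im z / Re z) - pi
  else Num.sg (Im z) * (pi / 2).

Definition clog z : R[i] := ln (cabs z) +i* Arg z.

(* Principal branch of w ^ a, meaningful for w != 0. *)
Definition cpow w a : R[i] := cexp (a * clog w).

Definition cintegral d (T : measurableType d) (mu : {measure set T -> \bar R})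
    (D : set T) (f : T -> R[i]) : R[i] :=
  (\int[mu]_(x in D) Re (f x)) +i* (\int[mu]_(x in D) Im (f x)).

(* Euler's integral, which converges for Re z > 0. *)
Definition Euler_integral z : R[i] :=
  cintegral (@lebesgue_measure R) `]0, +oo[
    (fun t => cpow t%:C (z - 1) * (expR (- t))%:C).

(* For n := Num.truncn (1 - Re z), n is the least natural number such that
   Re z + n > 0 (so n = 0 when Re z > 0), and Euler's integral is continued by
   Gamma(z) = Gamma(z + n) / (z (z + 1) ... (z + n - 1)).
   Meaningful for z outside {0, -1, -2, ...}. *)
Definition Gamma z : R[i] :=
  let n := Num.truncn (1 - Re z) in
  Euler_integral (z + n%:R) / \prod_(k < n) (z + k%:R).

End complex_functions.

Section circle.
Context {R : realType}.

Lemma twopi_gt0 : 0 < 2 * pi :> R.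
Proof. by rewrite mulr_gt0 // pi_gt0. Qed.

(* The measure m on the unit circle is the image under [expi] of the uniform
   probability [angle_measure] on [0, 2 pi]. A function on the circle is
   represented by any function on R[i] extending it, and is integrated, measured
   and normed through its composition with [expi]. *)
Definition expi (t : R) : R[i] := cos t +i* sin t.

Definition angle_measure := uniform_prob twopi_gt0.

Definition circle_integral (f : R[i] -> R[i]) : R[i] :=
  cintegral angle_measure [set: _] (fun t => f (expi t)).

Definition circle_Lnorm (p : \bar R) (f : R[i] -> R[i]) : \bar R :=
  Lnorm angle_measure p (fun t => (cabs (f (expi t)))%:E).

Definition circle_Lfun (p : \bar R) (f : R[i] -> R[i]) : Prop :=
  [/\ measurable_fun [set: R] (fun t => Re (f (expi t))),
      measurable_fun [set: R] (fun t => Im (f (expi t)))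
    & (circle_Lnorm p f < +oo)%E].

End circle.

Section real_derivative.
Context {R : realType}.

Definition pair_of_complex (z : R[i]) : R * R := (Re z, Im z).
Definition complex_of_pair (v : R * R) : R[i] := v.1 +i* v.2.

(* f as a map of the real plane, so that 'd is the real-linear derivative *)
Definition planar (f : R[i] -> R[i]) : R * R -> R * R :=
  pair_of_complex \o f \o complex_of_pair.

Definition real_differentiable (f : R[i] -> R[i]) (z : R[i]) : Prop :=
  differentiable (planar f) (pair_of_complex z).

Definition real_diff (f : R[i] -> R[i]) (z h : R[i]) : R[i] :=
  complex_of_pair ('d (planar f) (pair_of_complex z) (pair_of_complex h)).

(* The modulus is the Euclidean one, not the max norm of R * R. *)
Definition real_diff_norm (f : R[i] -> R[i]) (z : R[i]) : R :=
  sup [set cabs (real_diff f z h) | h in [set h | cabs h = 1]].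

End real_derivative.

Section poisson.
Context {R : realType}.
Implicit Types alpha beta z : R[i].

Definition u_kernel alpha beta z : R[i] :=
  cpow (1 - `|z| ^+ 2) (alpha + beta + 1) /
  (cpow (1 - z) (alpha + 1) * cpow (1 - z^*) (beta + 1)).

Definition c_coef alpha beta : R[i] :=
  Gamma (alpha + 1) * Gamma (beta + 1) / Gamma (alpha + beta + 1).

Definition poisson_integral alpha beta (f : R[i] -> R[i]) (z : R[i]) : R[i] :=
  circle_integral (fun zeta =>
    c_coef alpha beta * u_kernel alpha beta (z * zeta^*) * f zeta).

End poisson.

(* Main.v *)
Require Import Defs.
From HB Require Import structures.
From mathcomp Require Import all_boot all_order all_algebra.
From mathcomp Require Import all_classical all_reals all_analysis.
From mathcomp Require Import measurable_realfun ring lra.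
Import Order.TTheory GRing.Theory Num.Theory numFieldNormedType.Exports.
From mathcomp Require Import complex.

(* Write D = 1 - |z|^2 and s = Re alpha + Re beta + 1 > 0. Differentiation under
   the integral sign gives DP[phi](z)h as the integral of c Du(w)(h zeta^* ) phi(zeta)
   with w = z zeta^*, and |Du(w)| is at most a constant times
   D^(s-1) / |1 - w|^(s+1). This majorant is O(D^-2) pointwise and O(D^-1) in
   L^1(T). For the latter, |1 - w| = |e^(it) - z| dominates 1 - |z|, |cos t - Re z|
   and |sin t - Im z|, and 1 <= |sin t| + |cos t|; hence on each quarter of the
   circle the majorant lies below the derivative of an explicit bounded function
   of cos t and sin t. Cutting |phi| at height tau = ||phi||_p D^(-1/p), i.e. using
   |phi| <= tau^(1-p) |phi|^p + tau, combines both bounds into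
   D^(-1-1/p) ||phi||_p. As alpha <> -1, the numerator of the claimed bound is at
   least |alpha + 1| + |beta + 1| > 0 and is absorbed by the constant. *)

Set Implicit Arguments.
Unset Strict Implicit.
Unset Printing Implicit Defensive.

Local Open Scope classical_set_scope.
Local Open Scope ring_scope.
Local Open Scope complex_scope.

(** * Modulus, exponential and derivatives along real curves *)

(** Nothing is known beforehand about the regularity of the Poisson integral, so differentiability
    has to be proved along with the estimate. Writing the kernel as a single exponential
    [cexp (log_kernel w)] makes its first two derivatives along a segment explicit, and a Taylor
    remainder quadratic in h, uniform on |w| <= r < 1, survives integration against an L^1 density.
    This one expansion proves differentiability and identifies the derivative; no limit is exchanged
    with an integral. Its constant may blow up at the circle: sharp dependence on |z| matters only
    for the first derivative, where the kernel contributes D^s / |1 - w|^(s+1) and its logarithmic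
    derivative a factor 1/D. In the L^1(T) bound z stays arbitrary, so no rotation invariance of the
    measure is invoked; the weights |sin t| and |cos t| never vanish together and are, up to sign,
    the derivatives of cos t and sin t, which is what the chain rule needs. Truncation treats all
    finite p at once, without conjugate exponents: tau is the height at which both pieces have the
    same size. *)

Section modulus.
Context {R : realType}.
Implicit Types (z w a : R[i]) (x y : R).

Lemma normc_cabs z : `|z| = (cabs z)%:C.
Proof. by []. Qed.

Lemma cabs_ge0 z : 0 <= cabs z.
Proof. by case: z => x y; rewrite /cabs /= sqrtr_ge0. Qed.

Lemma cabsD z w : cabs (z + w) <= cabs z + cabs w.
Proof. exact: le_normcD. Qed.

Lemma cabsN z : cabs (- z) = cabs z.
Proof. exact: normcN. Qed.

Lemma cabsB z w : cabs (z - w) <= cabs z + cabs w.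
Proof. by rewrite -(cabsN w); exact: cabsD. Qed.

Lemma cabsM z w : cabs (z * w) = cabs z * cabs w.
Proof. exact: ComplexField.Normc.normcM. Qed.

Lemma cabsV z : cabs z^-1 = (cabs z)^-1.
Proof. exact: ComplexField.Normc.normcV. Qed.

Lemma cabs1 : cabs (1 : R[i]) = 1.
Proof. exact: ComplexField.Normc.normc1. Qed.

Lemma cabs_eq0 z : cabs z = 0 -> z = 0.
Proof. exact: ComplexField.Normc.eq0_normc. Qed.

Lemma cabs_gt0 z : z != 0 -> 0 < cabs z.
Proof.
by move=> z0; rewrite lt_neqAle cabs_ge0 andbT; apply: contra_neqN z0 => /eqP /esym /cabs_eq0.
Qed.

Lemma cabsJ z : cabs z^* = cabs z.
Proof. by case: z => x y; rewrite /cabs /= sqrrN. Qed.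

Lemma cabs_real x : cabs x%:C = `|x|.
Proof. by rewrite /cabs /= expr0n /= addr0 sqrtr_sqr. Qed.

Lemma sqr_cabs z : cabs z ^+ 2 = Re z ^+ 2 + Im z ^+ 2.
Proof. by case: z => x y; rewrite /cabs /= sqr_sqrtr// addr_ge0 ?sqr_ge0. Qed.

Lemma ReM z w : Re (z * w) = Re z * Re w - Im z * Im w.
Proof. by case: z; case: w. Qed.

Lemma ImM z w : Im (z * w) = Re z * Im w + Im z * Re w.
Proof. by case: z; case: w. Qed.

Lemma ReD z w : Re (z + w) = Re z + Re w. Proof. by case: z; case: w. Qed.
Lemma ImD z w : Im (z + w) = Im z + Im w. Proof. by case: z; case: w. Qed.
Lemma ReN z : Re (- z) = - Re z. Proof. by case: z. Qed.
Lemma ImN z : Im (- z) = - Im z. Proof. by case: z. Qed.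
Lemma ReJ z : Re z^* = Re z. Proof. by case: z. Qed.
Lemma ImJ z : Im z^* = - Im z. Proof. by case: z. Qed.

Lemma mulJc z : z * z^* = (cabs z ^+ 2)%:C.
Proof. by rewrite sqr_cabs; case: z => x y /=; simpc; congr (_ +i* _); ring. Qed.

Lemma ler_Re_cabs z : `|Re z| <= cabs z.
Proof.
by rewrite -(@ler_pXn2r _ 2)// ?nnegrE ?cabs_ge0//
  sqr_cabs real_normK ?num_real// lerDl sqr_ge0.
Qed.

Lemma ler_Im_cabs z : `|Im z| <= cabs z.
Proof.
by rewrite -(@ler_pXn2r _ 2)// ?nnegrE ?cabs_ge0//
  sqr_cabs real_normK ?num_real// lerDr sqr_ge0.
Qed.

Lemma cabs_le_ReIm z : cabs z <= `|Re z| + `|Im z|.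
Proof.
have -> : z = (Re z)%:C + (Im z)%:C * 'i by case: z => x y; simpc.
rewrite (le_trans (cabsD _ _))// cabsM !cabs_real.
by rewrite [cabs 'i]/cabs /= expr0n /= add0r expr1n sqrtr1 mulr1; case: z => x y; simpc.
Qed.

Lemma one_sub_gt0 z : cabs z < 1 -> 0 < Re (1 - z).
Proof.
move=> z1; rewrite ReD ReN /= subr_gt0 (le_lt_trans _ z1)//.
by rewrite (le_trans (ler_norm _))// ler_Re_cabs.
Qed.

Lemma Re_gt0_neq0 z : 0 < Re z -> z != 0.
Proof. by apply: contraTneq => ->; rewrite ltxx. Qed.

Lemma cexpD z w : cexp (z + w) = cexp z * cexp w.
Proof.
case: z w => x y [x' y']; rewrite /cexp /= expRD cosD sinD.
by simpc; congr (_ +i* _); ring.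
Qed.

Lemma cexp0 : cexp (0 : R[i]) = 1.
Proof. by rewrite /cexp /= expR0 cos0 sin0 !mul1r. Qed.

Lemma cexpN z : cexp (- z) = (cexp z)^-1.
Proof.
have H : cexp z * cexp (- z) = 1 by rewrite -cexpD subrr cexp0.
have z0 : cexp z != 0.
  by apply: contraPneq H => ->; rewrite mul0r => /esym/eqP; rewrite oner_eq0.
by apply: (mulfI z0); rewrite H divff.
Qed.

Lemma cabs_cexp z : cabs (cexp z) = expR (Re z).
Proof.
case: z => x y; rewrite /cabs /cexp /= !exprMn -mulrDr cos2Dsin2 mulr1.
by rewrite sqrtr_sqr ger0_norm// expR_ge0.
Qed.

End modulus.

(** * Derivatives and measurability of complex functions of a real variable *)

Section calculus.
Context {R : realType}.
Implicit Types (f g : R -> R[i]) (l : R[i]) (t : R).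

(* Derivative of a complex-valued function of a real variable; [R[i]] carries no
   normed R-module structure, so the two coordinates are treated separately. *)
Definition is_cderive t f l :=
  is_derive t 1 (fun x => Re (f x)) (Re l) /\
  is_derive t 1 (fun x => Im (f x)) (Im l).

Lemma is_cderive_eq t f l l' : is_cderive t f l -> l = l' -> is_cderive t f l'.
Proof. by move=> ? <-. Qed.

Lemma is_cderive_ext t f g l : f =1 g -> is_cderive t f l -> is_cderive t g l.
Proof. by move=> /funext ->. Qed.

Lemma is_cderive_cst t l : is_cderive t (cst l) 0.
Proof. by split; exact: is_derive_cst. Qed.

Lemma is_cderiveD t f g l m : is_cderive t f l -> is_cderive t g m ->
  is_cderive t (fun x => f x + g x) (l + m).
Proof.
move=> [fr fi] [gr gi]; split.
- rewrite (_ : (fun _ => _) = (fun x => Re (f x)) + (fun x => Re (g x))) ?ReD;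
    first exact: is_deriveD.
  by apply/funext => x /=; rewrite ReD.
- rewrite (_ : (fun _ => _) = (fun x => Im (f x)) + (fun x => Im (g x))) ?ImD;
    first exact: is_deriveD.
  by apply/funext => x /=; rewrite ImD.
Qed.

Lemma is_cderiveM t f g l m : is_cderive t f l -> is_cderive t g m ->
  is_cderive t (fun x => f x * g x) (l * g t + f t * m).
Proof.
move=> [fr fi] [gr gi]; split.
- rewrite (_ : (fun _ => _) = (fun x => Re (f x)) * (fun x => Re (g x)) -
    (fun x => Im (f x)) * (fun x => Im (g x))).
    by apply: (is_derive_eq (is_deriveB (is_deriveM fr gr) (is_deriveM fi gi)));
      rewrite ReD !ReM /GRing.scale /=; ring.
  by apply/funext => x /=; rewrite ReM.
- rewrite (_ : (fun _ => _) = (fun x => Re (f x)) * (fun x => Im (g x)) +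
    (fun x => Im (f x)) * (fun x => Re (g x))).
    by apply: (is_derive_eq (is_deriveD (is_deriveM fr gi) (is_deriveM fi gr)));
      rewrite ImD !ImM /GRing.scale /=; ring.
  by apply/funext => x /=; rewrite ImM.
Qed.

Lemma is_cderiveN t f l : is_cderive t f l -> is_cderive t (fun x => - f x) (- l).
Proof.
move=> fl; apply: is_cderive_eq; first apply: is_cderive_ext; last 2 first.
- exact: is_cderiveM (is_cderive_cst t (-1)) fl.
- by rewrite mul0r add0r mulN1r.
- by move=> x /=; rewrite mulN1r.
Qed.

Lemma is_cderiveB t f g l m : is_cderive t f l -> is_cderive t g m ->
  is_cderive t (fun x => f x - g x) (l - m).
Proof. by move=> fl gm; apply: is_cderiveD => //; exact: is_cderiveN. Qed.

Lemma is_cderiveZ t f l a : is_cderive t f l -> is_cderive t (fun x => a * f x) (a * l).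
Proof.
move=> fl; apply: is_cderive_eq; first exact: is_cderiveM (is_cderive_cst t a) fl.
by rewrite mul0r add0r.
Qed.

Lemma is_cderiveJ t f l : is_cderive t f l -> is_cderive t (fun x => (f x)^*) l^*.
Proof.
move=> [fr fi]; split.
- by rewrite ReJ; under eq_fun do rewrite ReJ.
- rewrite ImJ; under eq_fun do rewrite ImJ.
  exact: (@is_deriveN _ _ _ (fun x => Im (f x))).
Qed.

Lemma is_cderiveV t f l : f t != 0 -> is_cderive t f l ->
  is_cderive t (fun x => (f x)^-1) (- (l * (f t)^-1 * (f t)^-1)).
Proof.
move=> ft0 [fr fi].
have n0 : Re (f t) ^+ 2 + Im (f t) ^+ 2 != 0.
  by rewrite -sqr_cabs expf_neq0// gt_eqF// cabs_gt0.
pose N := (fun x => Re (f x)) ^+ 2 + (fun x => Im (f x)) ^+ 2.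
have Nt : N t = Re (f t) ^+ 2 + Im (f t) ^+ 2 by [].
have dN0 : is_derive t 1 N (2 * Re (f t) * Re l + 2 * Im (f t) * Im l).
  have := is_deriveD (is_deriveX 2 fr) (is_deriveX 2 fi).
  by rewrite /GRing.scale /= !expr1.
have dN := is_deriveV (n0 : N t != 0) dN0.
have ReV z : Re z^-1 = Re z * (Re z ^+ 2 + Im z ^+ 2)^-1 by case: z.
have ImV z : Im z^-1 = - Im z * (Re z ^+ 2 + Im z ^+ 2)^-1 by case: z => ? ?; rewrite /= mulNr.
split.
- rewrite (_ : (fun _ => _) = (fun x => Re (f x)) * (fun x => (N x)^-1)); last first.
    by apply/funext => x /=; rewrite ReV.
  apply: (is_derive_eq (is_deriveM fr dN)).
  rewrite !(ReN, ReM, ImM, ReV, ImV) /GRing.scale /= Nt.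
  by field.
- rewrite (_ : (fun _ => _) = - (fun x => Im (f x)) * (fun x => (N x)^-1)); last first.
    by apply/funext => x /=; rewrite ImV.
  apply: (is_derive_eq (is_deriveM (is_deriveN fi) dN)).
  rewrite -[(- (fun _ => _)) t]/(- Im (f t)).
  rewrite !(ImN, ReM, ImM, ReV, ImV) /GRing.scale /= Nt.
  by field.
Qed.

Lemma is_cderive_cexp t f l : is_cderive t f l ->
  is_cderive t (fun x => cexp (f x)) (cexp (f t) * l).
Proof.
move=> [fr fi]; split.
- rewrite (_ : (fun _ => _) = (expR \o (fun x => Re (f x))) * (cos \o (fun x => Im (f x)))) //.
  by apply: is_derive_eq; rewrite ReM /GRing.scale /=; ring.
- rewrite (_ : (fun _ => _) = (expR \o (fun x => Re (f x))) * (sin \o (fun x => Im (f x)))) //.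
  by apply: is_derive_eq; rewrite ImM /GRing.scale /=; ring.
Qed.

Lemma near_gt0 (h : R -> R) t (d : R) : is_derive t 1 h d -> 0 < h t ->
  \forall x \near t, 0 < h x.
Proof.
move=> [/derivable1_diffP/differentiable_continuous hc _] h0.
exact: (hc _ (lt_nbhsr h0)).
Qed.

Lemma ln_cabs l : 0 < Re l -> ln (cabs l) = 2^-1 * ln (Re l ^+ 2 + Im l ^+ 2).
Proof.
move=> l0; have c0 : 0 < cabs l by rewrite cabs_gt0// Re_gt0_neq0.
by rewrite -sqr_cabs expr2 lnM ?posrE//; field.
Qed.

(** On the right half-plane the two coordinates of [clog] are ln(Re^2 + Im^2) / 2 and atan(Im / Re).
    The case distinction in [Arg] is resolved only where Re stays positive, hence the passage
    through equality near t. *)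
Lemma is_cderive_clog t f l : 0 < Re (f t) -> is_cderive t f l ->
  is_cderive t (fun x => clog (f x)) (l / f t).
Proof.
move=> ft0 [fr fi].
have n0 : 0 < Re (f t) ^+ 2 + Im (f t) ^+ 2 by rewrite ltr_wpDr ?sqr_ge0// exprn_gt0.
have near0 : \forall x \near t, 0 < Re (f x) by exact: near_gt0 fr ft0.
have ReV z : Re z^-1 = Re z * (Re z ^+ 2 + Im z ^+ 2)^-1 by case: z.
have ImV z : Im z^-1 = - Im z * (Re z ^+ 2 + Im z ^+ 2)^-1 by case: z => ? ?; rewrite /= mulNr.
split.
- have dN := is_deriveD (is_deriveX 2 fr) (is_deriveX 2 fi).
  have dlog := is_derive1_comp (is_derive1_ln
    (n0 : 0 < ((fun x => Re (f x)) ^+ 2 + (fun x => Im (f x)) ^+ 2) t)) dN.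
  have := is_deriveZ (2^-1 : R) dlog.
  set g := (X in is_derive _ _ X _) => dg.
  have gf : \forall x \near t, g x = Re (clog (f x)).
    by near=> x; rewrite /= ln_cabs//; near: x.
  apply: is_derive_eq (near_eq_is_derive gf dg) _.
  rewrite ReM ReV ImV /GRing.scale /= !expr1.
  rewrite -[(_ ^+ 2 + _) t]/(Re (f t) ^+ 2 + Im (f t) ^+ 2).
  by field; rewrite gt_eqF.
- have ftn0 : Re (f t) != 0 by rewrite gt_eqF.
  have := is_derive1_comp (is_derive1_atan _) (is_deriveM fi (is_deriveV ftn0 fr)).
  set g := (X in is_derive _ _ X _) => dg.
  have gf : \forall x \near t, g x = Im (clog (f x)).
    by near=> x; rewrite /= /Arg ifT//; near: x.
  apply: is_derive_eq (near_eq_is_derive gf dg) _.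
  rewrite ImM ReV ImV /GRing.scale /=.
  rewrite -[((_ : R -> R) * _) t]/(Im (f t) / Re (f t)).
  have q0 : 1 + (Im (f t) / Re (f t)) ^+ 2 != 0 by rewrite gt_eqF// ltr_wpDr ?sqr_ge0.
  by field; rewrite gt_eqF//= gt_eqF.
Unshelve. all: by end_near. Qed.

Lemma is_cderive_expi t : is_cderive t expi ('i * expi t).
Proof.
split.
- by apply: is_derive_eq; rewrite /expi ReM /=; ring.
- by apply: is_derive_eq; rewrite /expi ImM /=; ring.
Qed.

Lemma is_cderive_id t : is_cderive t (fun x : R => x%:C) 1.
Proof. by split; [exact: is_derive_id|exact: is_derive_cst]. Qed.

Lemma is_cderive_continuous f : (forall t, exists l, is_cderive t f l) ->
  continuous (fun x => Re (f x)) /\ continuous (fun x => Im (f x)).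
Proof.
move=> df; split=> t; have [l [[dr _] [di _]]] := df t.
  exact: (differentiable_continuous (proj1 (derivable1_diffP _ _) dr)).
exact: (differentiable_continuous (proj1 (derivable1_diffP _ _) di)).
Qed.

Definition cmeasurable f := measurable_fun setT (fun x => Re (f x)) /\
  measurable_fun setT (fun x => Im (f x)).

(** Source of measurability for all kernels on the circle: they are differentiable in the angle. *)
Lemma is_cderive_measurable f : (forall t, exists l, is_cderive t f l) -> cmeasurable f.
Proof.
by move=> /is_cderive_continuous[? ?]; split; exact: continuous_measurable_fun.
Qed.

Lemma cmeasurableM f g : cmeasurable f -> cmeasurable g -> cmeasurable (fun x => f x * g x).
Proof.
move=> [fr fi] [gr gi]; split.
- by under eq_fun do rewrite ReM; apply: measurable_funB; exact: measurable_funM.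
- by under eq_fun do rewrite ImM; apply: measurable_funD; exact: measurable_funM.
Qed.

Lemma cmeasurable_cabs f : cmeasurable f -> measurable_fun setT (fun x => cabs (f x)).
Proof.
move=> [fr fi].
rewrite (_ : (fun _ => _) = fun x => (Re (f x) ^+ 2 + Im (f x) ^+ 2) `^ 2^-1).
  apply: measurableT_comp (measurable_powR _) _.
  by apply: measurable_funD; exact: measurable_funX.
apply/funext => x; rewrite -sqr_cabs -powR_mulrn ?cabs_ge0// -powRrM divff//.
by rewrite powRr1 ?cabs_ge0.
Qed.

End calculus.

(** * The kernel and its expansion to second order *)

Section taylor.
Context {R : realType}.

Lemma MVT_unit (F F' : R -> R) (c : R) : 0 <= c -> c <= 1 ->
  (forall t : R, 0 <= t <= 1 -> is_derive t 1 F (F' t)) ->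
  exists d, 0 <= d <= 1 /\ F c - F 0 = F' d * c.
Proof.
move=> c0 c1 dF.
have dF' t : t \in `[0, c]%R -> is_derive t 1 F (F' t).
  rewrite in_itv /= => /andP[t0 tc]; apply: dF; rewrite t0 (le_trans tc)//.
have dFo t : t \in `]0, c[%R -> is_derive t 1 F (F' t).
  by rewrite in_itv /= => /andP[t0 tc]; apply: dF'; rewrite in_itv /= !ltW.
have cF : {within `[0, c], continuous F}.
  by apply: derivable_within_continuous => t /dF'[].
have [d] := MVT_segment c0 dFo cF.
rewrite in_itv /= subr0 => /andP[d0 dc] e; exists d; split=> //.
by rewrite d0 (le_trans dc c1).
Qed.

(** The mean value theorem applied twice: the remainder is F1 c - F1 0 = F2 d * c with 0 <= c <= 1.
    The lost factor 1/2 does not matter. *)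
Lemma taylor2_unit (F F1 F2 : R -> R) (M : R) :
  (forall t : R, 0 <= t <= 1 -> is_derive t 1 F (F1 t)) ->
  (forall t : R, 0 <= t <= 1 -> is_derive t 1 F1 (F2 t)) ->
  (forall t : R, 0 <= t <= 1 -> `|F2 t| <= M) ->
  `|F 1 - F 0 - F1 0| <= M.
Proof.
move=> dF dF1 F2M.
have [c [/andP[c0 c1] ->]] := MVT_unit ler01 (lexx 1) dF.
have [d [d01 e]] := MVT_unit c0 c1 dF1.
rewrite mulr1 e normrM (ger0_norm c0) (le_trans _ (F2M _ d01))//.
by rewrite ler_piMr.
Qed.

(** The mean value theorem fails for complex values, so each coordinate is expanded separately; this
    costs the factor 2. *)
Lemma cderive_taylor2 (G G1 G2 : R -> R[i]) (M : R) :
  (forall t : R, 0 <= t <= 1 -> is_cderive t G (G1 t)) ->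
  (forall t : R, 0 <= t <= 1 -> is_cderive t G1 (G2 t)) ->
  (forall t : R, 0 <= t <= 1 -> cabs (G2 t) <= M) ->
  cabs (G 1 - G 0 - G1 0) <= 2 * M.
Proof.
move=> dG dG1 G2M.
rewrite (le_trans (cabs_le_ReIm _))// mulr_natl mulr2n lerD//.
- rewrite !(ReD, ReN).
  apply: (@taylor2_unit (fun t => Re (G t)) (fun t => Re (G1 t)) (fun t => Re (G2 t))).
  + by move=> t /dG[].
  + by move=> t /dG1[].
  + by move=> t /G2M; exact/le_trans/ler_Re_cabs.
- rewrite !(ImD, ImN).
  apply: (@taylor2_unit (fun t => Im (G t)) (fun t => Im (G1 t)) (fun t => Im (G2 t))).
  + by move=> t /dG[].
  + by move=> t /dG1[].
  + by move=> t /G2M; exact/le_trans/ler_Im_cabs.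
Qed.

End taylor.

(** * The logarithm of the kernel, its derivatives and their bounds *)

Section kernel.
Context {R : realType}.
Variables alpha beta : R[i].
Implicit Types (w h : R[i]) (r t : R).

Let s := Re alpha + Re beta + 1.

(* [dlog_kernel w h] and [d2log_kernel w h] are the first two derivatives at 0 of
   [fun t => log_kernel (w + t h)]. *)
Definition log_kernel w := (alpha + beta + 1) * clog (1 - w * w^*)
  - ((alpha + 1) * clog (1 - w) + (beta + 1) * clog (1 - w^*)).

Definition dlog_kernel w h :=
  (alpha + beta + 1) * (- (h * w^* + w * h^*) * (1 - w * w^*)^-1)
  + ((alpha + 1) * (h * (1 - w)^-1) + (beta + 1) * (h^* * (1 - w^*)^-1)).

Definition d2log_kernel w h :=
  (alpha + beta + 1) * (- (h * h^* + h * h^*) * (1 - w * w^*)^-1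
    - ((h * w^* + w * h^*) * (1 - w * w^*)^-1) ^+ 2)
  + ((alpha + 1) * (h * (1 - w)^-1) ^+ 2 + (beta + 1) * (h^* * (1 - w^*)^-1) ^+ 2).

(** With all three powers merged into one exponential, every derivative of the kernel is the kernel
    times an expression in the derivatives of [log_kernel]. *)
Lemma u_kernelE w : u_kernel alpha beta w = cexp (log_kernel w).
Proof.
rewrite /u_kernel /cpow -cexpD -cexpN -cexpD /log_kernel mulJc normc_cabs.
by rewrite -rmorphXn.
Qed.

Lemma one_sub_mulJ_gt0 w : cabs w < 1 -> 0 < Re (1 - w * w^*).
Proof.
move=> w1; rewrite mulJc ReD ReN /= subr_gt0.
by rewrite expr_lt1// cabs_ge0.
Qed.

Lemma is_cderive_log_kernel (g : R -> R[i]) l t : cabs (g t) < 1 -> is_cderive t g l ->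
  is_cderive t (fun x => log_kernel (g x)) (dlog_kernel (g t) l).
Proof.
move=> gt1 dg; have dgJ := is_cderiveJ dg.
have gt1J : cabs (g t)^* < 1 by rewrite cabsJ.
have d1 := is_cderive_cst t (1 : R[i]).
have dN := is_cderive_clog (one_sub_mulJ_gt0 gt1) (is_cderiveB d1 (is_cderiveM dg dgJ)).
have da := is_cderive_clog (one_sub_gt0 gt1) (is_cderiveB d1 dg).
have db := is_cderive_clog (one_sub_gt0 gt1J) (is_cderiveB d1 dgJ).
apply: is_cderive_eq (is_cderiveB (is_cderiveZ (alpha + beta + 1) dN)
  (is_cderiveD (is_cderiveZ (alpha + 1) da) (is_cderiveZ (beta + 1) db))) _.
by rewrite /dlog_kernel /cst; ring.
Qed.

Lemma is_cderive_u_kernel (g : R -> R[i]) l t : cabs (g t) < 1 -> is_cderive t g l ->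
  is_cderive t (fun x => u_kernel alpha beta (g x))
    (u_kernel alpha beta (g t) * dlog_kernel (g t) l).
Proof.
move=> gt1 dg; apply: (is_cderive_ext (f := fun x => cexp (log_kernel (g x)))).
  by move=> x; rewrite u_kernelE.
by rewrite u_kernelE; apply/is_cderive_cexp/is_cderive_log_kernel.
Qed.

(** Point and direction move along independent curves because there are two uses. On a segment with
    constant direction the value of the derivative is needed; when both rotate with the angle, its
    existence is enough, for measurability. *)
Lemma is_cderive_dlog_kernel (g k : R -> R[i]) l m t : cabs (g t) < 1 ->
  is_cderive t g l -> is_cderive t k m ->
  exists d, is_cderive t (fun x => dlog_kernel (g x) (k x)) d /\
    (m = 0 -> l = k t -> d = d2log_kernel (g t) (k t)).
Proof.
move=> gt1 dg dk; have dgJ := is_cderiveJ dg; have dkJ := is_cderiveJ dk.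
have gt1J : cabs (g t)^* < 1 by rewrite cabsJ.
have d1 := is_cderive_cst t (1 : R[i]).
have dN := is_cderiveV (Re_gt0_neq0 (one_sub_mulJ_gt0 gt1))
  (is_cderiveB d1 (is_cderiveM dg dgJ)).
have da := is_cderiveV (Re_gt0_neq0 (one_sub_gt0 gt1)) (is_cderiveB d1 dg).
have db := is_cderiveV (Re_gt0_neq0 (one_sub_gt0 gt1J)) (is_cderiveB d1 dgJ).
have dM := is_cderiveN (is_cderiveD (is_cderiveM dk dgJ) (is_cderiveM dg dkJ)).
have := is_cderiveD (is_cderiveZ (alpha + beta + 1) (is_cderiveM dM dN))
  (is_cderiveD (is_cderiveZ (alpha + 1) (is_cderiveM dk da))
     (is_cderiveZ (beta + 1) (is_cderiveM dkJ db))).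
set d := (X in is_cderive _ _ X) => H; exists d; split => // m0 lk.
by rewrite /d m0 lk conjc0 /d2log_kernel /cst; ring.
Qed.

Lemma clog_real (x : R) : 0 < x -> clog x%:C = (ln x)%:C.
Proof.
by move=> x0; rewrite /clog cabs_real gtr0_norm// /Arg /= x0 mul0r atan0.
Qed.

Lemma clogJ w : 0 < Re w -> clog w^* = (clog w)^*.
Proof.
by move=> w0; rewrite /clog cabsJ /Arg ReJ ImJ w0 mulNr atanN.
Qed.

Lemma Im_clog_le w : 0 < Re w -> `|Im (clog w)| <= pi / 2.
Proof.
move=> w0; rewrite /= /Arg w0 ler_norml.
by rewrite !ltW ?atan_gtNpi2 ?atan_ltpi2.
Qed.

Lemma one_sub_cabs_le w : 1 - cabs w <= cabs (1 - w).
Proof.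
have := cabsD (1 - w) w; rewrite subrK cabs1; lra.
Qed.

Lemma one_sub_cabs_sqr_le w : cabs w < 1 -> 1 - cabs w ^+ 2 <= 2 * cabs (1 - w).
Proof.
move=> w1; have := one_sub_cabs_le w; have := cabs_ge0 w.
nra.
Qed.

Lemma one_sub_cabs_sqr_gt0 w : cabs w < 1 -> 0 < 1 - cabs w ^+ 2.
Proof. by move=> w1; rewrite subr_gt0 expr_lt1// cabs_ge0. Qed.

(** With th = arg(1 - w), the real part of [log_kernel w] is s ln D - (s + 1) ln|1 - w| + (Im alpha
    - Im beta) th. Since 1 - w lies in the right half-plane, |th| <= pi / 2, which gives the
    exponential constant. *)
Lemma cabs_u_kernel_le w : cabs w < 1 -> cabs (u_kernel alpha beta w) <=
  expR ((`|Im alpha| + `|Im beta|) * (pi / 2)) *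
  ((1 - cabs w ^+ 2) `^ s * cabs (1 - w) `^ (- (s + 1))).
Proof.
move=> w1; have D0 := one_sub_cabs_sqr_gt0 w1; have g0 := one_sub_gt0 w1.
have c0 : 0 < cabs (1 - w) by apply/cabs_gt0/Re_gt0_neq0.
rewrite u_kernelE cabs_cexp /powR !gt_eqF// -!expRD ler_expR.
rewrite /log_kernel mulJc -(rmorphB _ 1) clog_real//.
have -> : 1 - w^* = (1 - w)^* by rewrite rmorphB rmorph1.
rewrite clogJ//; have := Im_clog_le g0.
set th := Im (clog _) => th_le.
have : Re (clog (1 - w)) = ln (cabs (1 - w)) by [].
set L := ln (cabs _) => ReL.
rewrite !(ReD, ReN, ReM, ImD, ImN, ReJ, ImJ) ReL -/th /= /s.
have h1 : Im alpha * th <= `|Im alpha| * (pi / 2).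
  by rewrite (le_trans (ler_norm _))// normrM ler_wpM2l.
have h2 : - Im beta * th <= `|Im beta| * (pi / 2).
  by rewrite (le_trans (ler_norm _))// normrM normrN ler_wpM2l.
nra.
Qed.

Let A := 2 * (cabs (alpha + beta + 1) + (cabs (alpha + 1) + cabs (beta + 1))).

(** Each of the three terms costs 2|h|/D: the first by its two summands in the numerator, the others
    by 1 - |w|^2 <= 2|1 - w|. This is the factor 2 in [A]. *)
Lemma cabs_dlog_kernel_le w h : cabs w < 1 ->
  cabs (dlog_kernel w h) <= A * (cabs h * (1 - cabs w ^+ 2)^-1).
Proof.
move=> w1; have D0 := one_sub_cabs_sqr_gt0 w1.
have w1J : cabs w^* < 1 by rewrite cabsJ.
have gV (v : R[i]) : cabs v < 1 -> (cabs (1 - v))^-1 <= 2 * (1 - cabs v ^+ 2)^-1.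
  move=> v1; have Dv := one_sub_cabs_sqr_gt0 v1.
  have cv : 0 < cabs (1 - v) by apply/cabs_gt0/Re_gt0_neq0/one_sub_gt0.
  rewrite -[2]invrK -invfM lef_pV2 ?posrE ?mulr_gt0 ?invr_gt0//.
  by rewrite ler_pdivrMl// one_sub_cabs_sqr_le.
have num : cabs (h * w^* + w * h^*) <= 2 * cabs h.
  rewrite (le_trans (cabsD _ _))// !cabsM !cabsJ.
  have := cabs_ge0 h; have := cabs_ge0 w; nra.
rewrite /dlog_kernel (le_trans (cabsD _ _))//.
have -> : A * (cabs h * (1 - cabs w ^+ 2)^-1) =
  cabs (alpha + beta + 1) * (2 * cabs h * (1 - cabs w ^+ 2)^-1) +
  (cabs (alpha + 1) * (cabs h * (2 * (1 - cabs w ^+ 2)^-1)) +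
   cabs (beta + 1) * (cabs h * (2 * (1 - cabs w ^+ 2)^-1))) by rewrite /A; ring.
apply: lerD.
  rewrite cabsM ler_wpM2l ?cabs_ge0// cabsM cabsN mulJc -(rmorphB _ 1).
  rewrite cabsV cabs_real gtr0_norm//.
  by rewrite ler_wpM2r// invr_ge0 ltW.
rewrite (le_trans (cabsD _ _))// !cabsM !cabsV cabsJ lerD// !ler_wpM2l ?cabs_ge0//.
- exact: gV.
- by have := gV _ w1J; rewrite cabsJ.
Qed.

(** Deliberately crude, as it only serves the Taylor remainder: every denominator is replaced by 1 -
    r. The first term of [d2log_kernel] gives 2 + 4 = 6 (using K <= K^2), the other coefficients are
    raised to 6, and 6 is 3 times the 2 inside [A]. *)
Lemma cabs_d2log_kernel_le r w h : cabs w <= r -> r < 1 ->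
  cabs (d2log_kernel w h) <= 3 * A * ((1 - r)^-1 * cabs h) ^+ 2.
Proof.
move=> wr r1; set K := (1 - r)^-1.
have w1 : cabs w < 1 by exact: le_lt_trans wr r1.
have D0 := one_sub_cabs_sqr_gt0 w1.
have r0 : 0 < 1 - r by rewrite subr_gt0.
have K1 : 1 <= K by rewrite invf_ge1// gerBl (le_trans (cabs_ge0 _) wr).
have gV (v : R[i]) : cabs v <= r -> (cabs (1 - v))^-1 <= K.
  move=> vr; have vp : 0 < cabs (1 - v).
    by apply/cabs_gt0/Re_gt0_neq0/one_sub_gt0; exact: le_lt_trans vr r1.
  rewrite lef_pV2 ?posrE//; have := one_sub_cabs_le v; lra.
have K0 : 0 <= K by exact: le_trans K1.
have NV : cabs (1 - w * w^*)^-1 <= K.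
  rewrite cabsV; apply: gV; rewrite cabsM cabsJ.
  have := cabs_ge0 w; nra.
have num : cabs (h * w^* + w * h^*) <= 2 * cabs h.
  rewrite (le_trans (cabsD _ _))// !cabsM !cabsJ.
  have := cabs_ge0 h; have := cabs_ge0 w; nra.
have h0 := cabs_ge0 h.
have cX (z : R[i]) : cabs (z ^+ 2) = cabs z ^+ 2 by rewrite !expr2 cabsM.
have -> : 3 * A * (K * cabs h) ^+ 2 =
  cabs (alpha + beta + 1) * (6 * (K * cabs h) ^+ 2) +
  (cabs (alpha + 1) * (6 * (K * cabs h) ^+ 2) +
   cabs (beta + 1) * (6 * (K * cabs h) ^+ 2)) by rewrite /A; ring.
have kh0 : 0 <= (K * cabs h) ^+ 2 by exact: sqr_ge0.
rewrite /d2log_kernel (le_trans (cabsD _ _))// lerD//.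
  rewrite cabsM ler_wpM2l ?cabs_ge0// (le_trans (cabsB _ _))//.
  have -> : 6 * (K * cabs h) ^+ 2 = 2 * (K * cabs h) ^+ 2 + 4 * (K * cabs h) ^+ 2 by ring.
  rewrite lerD//.
    have -> : h * h^* + h * h^* = 2 * (h * h^*) by ring.
    rewrite cabsM cabsN !cabsM cabsJ (_ : cabs 2 = 2); last first.
      by rewrite -(rmorph_nat (real_complex R)) cabs_real ger0_norm.
    rewrite (_ : 2 * (K * cabs h) ^+ 2 = 2 * (cabs h * cabs h) * (K * K)); last ring.
    have KK : K * 1 <= K * K by rewrite ler_wpM2l// (le_trans ler01).
    by rewrite ler_wpM2l ?mulr_ge0// (le_trans NV)// (le_trans _ KK)// mulr1.
  rewrite cX (_ : 4 * _ = (2 * cabs h * K) ^+ 2); last ring.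
  rewrite lerXn2r ?nnegrE ?cabs_ge0 ?(mulr_ge0 (mulr_ge0 _ _))//.
  by rewrite cabsM ler_pM ?cabs_ge0.
have hV (v : R[i]) : cabs v <= r -> cabs h * (cabs (1 - v))^-1 <= K * cabs h.
  by move=> vr; rewrite mulrC ler_wpM2r// gV.
have hV2 (v : R[i]) : cabs v <= r ->
    (cabs h * (cabs (1 - v))^-1) ^+ 2 <= 6 * (K * cabs h) ^+ 2.
  move=> vr; apply: (@le_trans _ _ ((K * cabs h) ^+ 2)).
    by apply: lerXn2r; rewrite ?nnegrE ?mulr_ge0 ?invr_ge0 ?cabs_ge0 ?hV// ltW.
  by rewrite ler_peMl// ler1n.
rewrite (le_trans (cabsD _ _))// lerD// cabsM cX cabsM cabsV ?cabsJ ler_wpM2l ?cabs_ge0//.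
- exact: hV2.
- by have := hV2 w^*; rewrite cabsJ; exact.
Qed.

(** Positivity of s gives D^s <= 1, and |1 - w| >= 1 - r bounds the denominator. *)
Lemma cabs_u_kernel_bounded r : 0 <= r -> r < 1 -> 0 < s -> exists2 M, 0 <= M &
  forall w, cabs w <= r -> cabs (u_kernel alpha beta w) <= M.
Proof.
move=> r0 r1 s0.
exists (expR ((`|Im alpha| + `|Im beta|) * (pi / 2)) * (1 - r) `^ (- (s + 1))).
  by rewrite mulr_ge0 ?expR_ge0 ?powR_ge0.
move=> w wr; have w1 := le_lt_trans wr r1.
rewrite (le_trans (cabs_u_kernel_le w1))// ler_wpM2l ?expR_ge0//.
have D0 := one_sub_cabs_sqr_gt0 w1.
have rw : 1 - r <= cabs (1 - w) by have := one_sub_cabs_le w; lra.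
have c0 : 0 < 1 - r by lra.
rewrite -[leRHS]mul1r ler_pM ?powR_ge0//.
  have D1 : 0 < 1 - cabs w ^+ 2 <= 1 by rewrite D0 gerBl sqr_ge0.
  by rewrite (le_trans (ger_powR D1 (ltW s0)))// powRr0.
rewrite !powRN lef_pV2 ?posrE ?powR_gt0//; last exact: lt_le_trans rw.
by apply: ge0_ler_powR; rewrite ?nnegrE ?cabs_ge0 ?(ltW c0)// addr_ge0// ltW.
Qed.

Lemma u_kernel_taylor r : 0 <= r -> r < 1 -> 0 < s -> exists M, forall w h,
  cabs w <= r -> cabs h <= (1 - r) / 2 ->
  cabs (u_kernel alpha beta (w + h) - u_kernel alpha beta w
        - u_kernel alpha beta w * dlog_kernel w h) <= M * cabs h ^+ 2.
Proof.
(* [rho] is the midpoint of r and 1: the segment from w to w + h stays in the disc of this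
   radius. *)
move=> r0 r1 s0; set rho := (1 + r) / 2.
have rho0 : 0 <= rho by rewrite /rho; lra.
have rho1 : rho < 1 by rewrite /rho; lra.
have [B B0 uB] := cabs_u_kernel_bounded rho0 rho1 s0.
have A0 : 0 <= A by rewrite /A !(mulr_ge0, addr_ge0, cabs_ge0).
pose K := (1 - rho)^-1.
have K0 : 0 <= K by rewrite invr_ge0 subr_ge0 ltW.
(* The second derivative along the segment is u (dlog^2 + d2log); [B], [(A * K) ^+ 2] and
   [3 * A * K ^+ 2] bound its ingredients, and 2 comes from [cderive_taylor2]. *)
exists (2 * (B * ((A * K) ^+ 2 + 3 * A * K ^+ 2))) => w h wr hr.
pose g t := w + t%:C * h.
have gr (t : R) : 0 <= t <= 1 -> cabs (g t) <= rho.
  move=> /andP[t0 t1]; rewrite /g (le_trans (cabsD _ _))// cabsM cabs_real ger0_norm//.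
  have := cabs_ge0 h; rewrite /rho; nra.
have dg (t : R) : is_cderive t g h.
  apply: is_cderive_eq (is_cderiveD (is_cderive_cst t w)
    (is_cderiveM (is_cderive_id t) (is_cderive_cst t h))) _.
  by rewrite /cst; ring.
have g1 : g 1 = w + h by rewrite /g mul1r.
have g0 : g 0 = w by rewrite /g mul0r addr0.
have gt1 (t : R) : 0 <= t <= 1 -> cabs (g t) < 1.
  by move=> /gr /le_lt_trans; exact.
have d1 (t : R) : 0 <= t <= 1 ->
    is_cderive t (fun t => dlog_kernel (g t) h) (d2log_kernel (g t) h).
  move=> t01.
  have [d [dd dE]] := is_cderive_dlog_kernel (gt1 t t01) (dg t) (is_cderive_cst t h).
  by apply: is_cderive_eq dd _; rewrite dE.
rewrite -[leRHS]mulrA.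
have := @cderive_taylor2 _ (fun t => u_kernel alpha beta (g t))
  (fun t => u_kernel alpha beta (g t) * dlog_kernel (g t) h)
  (fun t => u_kernel alpha beta (g t) * dlog_kernel (g t) h * dlog_kernel (g t) h +
    u_kernel alpha beta (g t) * d2log_kernel (g t) h)
  (B * ((A * K) ^+ 2 + 3 * A * K ^+ 2) * cabs h ^+ 2).
rewrite g1 g0; apply.
- by move=> t t01; apply: is_cderive_u_kernel => //; exact: gt1.
- move=> t t01; have du := is_cderive_u_kernel (gt1 t t01) (dg t).
  by apply: is_cderive_eq (is_cderiveM du (d1 t t01)) _; ring.
- move=> t t01; rewrite (_ : _ + _ = u_kernel alpha beta (g t) *
      (dlog_kernel (g t) h * dlog_kernel (g t) h + d2log_kernel (g t) h)); last ring.
  rewrite cabsM -[leRHS]mulrA ler_pM ?cabs_ge0//; first exact/uB/gr.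
  have dl : cabs (dlog_kernel (g t) h) <= A * K * cabs h.
    rewrite (le_trans (cabs_dlog_kernel_le _ (gt1 t t01)))// -mulrA ler_wpM2l//.
    rewrite mulrC ler_wpM2r ?cabs_ge0// lef_pV2 ?posrE ?subr_gt0 ?expr_lt1 ?cabs_ge0 ?gt1//.
    have := gr t t01; have := cabs_ge0 (g t); have := gt1 t t01; nra.
  rewrite (le_trans (cabsD _ _))// [leRHS]mulrDl lerD//.
    rewrite cabsM -exprMn expr2 ler_pM ?cabs_ge0//.
  rewrite (le_trans (cabs_d2log_kernel_le _ (gr t t01) rho1))// -/K.
  by rewrite exprMn !mulrA.
Qed.

End kernel.

(** * A bounded primitive of the majorant *)

Section smoothed_sign.
Context {R : realType}.
Variables (delta s : R).
Hypotheses (delta0 : 0 < delta) (s0 : 0 < s).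
Implicit Types v : R.

(** Smooth substitute for |v| that stays above the scale [delta]. *)
Definition hypot v := Num.sqrt (delta ^+ 2 + v ^+ 2).

Lemma hypot_gt0 v : 0 < hypot v.
Proof. by rewrite sqrtr_gt0 ltr_wpDr ?sqr_ge0// exprn_gt0. Qed.

Lemma sqr_hypot v : hypot v ^+ 2 = delta ^+ 2 + v ^+ 2.
Proof. by rewrite sqr_sqrtr// addr_ge0 ?sqr_ge0. Qed.

Lemma normr_lt_hypot v : `|v| < hypot v.
Proof.
rewrite -(@ltr_pXn2r _ 2)// ?nnegrE ?(ltW (hypot_gt0 _))// sqr_hypot.
by rewrite real_normK ?num_real// ltrDr exprn_gt0.
Qed.

Lemma hypot_addl_gt0 v : 0 < v + hypot v.
Proof. have := normr_lt_hypot v; have := ler_norm (- v); rewrite normrN; lra. Qed.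

Lemma hypot_subr_gt0 v : 0 < hypot v - v.
Proof. have := normr_lt_hypot v; have := ler_norm v; lra. Qed.

(* With q = hypot v, the identity (v + q) (q - v) = delta^2 makes the derivative
   of this bounded function comparable to q^(-(s+1)) for both signs of v. *)
Definition smoothed_sign v := - ((v + hypot v) `^ s + delta `^ s)^-1.

Lemma is_derive_hypot v : is_derive v 1 hypot (v / hypot v).
Proof.
have p0 : 0 < delta ^+ 2 + v ^+ 2 by rewrite ltr_wpDr ?sqr_ge0// exprn_gt0.
have d1 := is_deriveD (is_derive_cst (delta ^+ 2) v 1) (is_deriveX 2 (is_derive_id v 1)).
have dN := is_derive1_comp (is_derive1_sqrt
  (p0 : 0 < (cst (delta ^+ 2) + @id R ^+ 2) v)) d1.
apply: is_derive_eq dN _.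
rewrite -[(cst _ + _) v]/(delta ^+ 2 + v ^+ 2) -/(hypot v) /GRing.scale /=.
by have := hypot_gt0 v => q0; field; rewrite gt_eqF.
Qed.

(** With q = hypot v, the derivative of v + q is (v + q)/q, which turns the power s - 1 from the
    chain rule back into s. *)
Lemma is_derive_smoothed_sign v : is_derive v 1 smoothed_sign
  (s * (v + hypot v) `^ s / (hypot v * ((v + hypot v) `^ s + delta `^ s) ^+ 2)).
Proof.
have a0 := hypot_addl_gt0 v; have q0 := hypot_gt0 v.
have n0 : 0 < (v + hypot v) `^ s + delta `^ s by rewrite addr_gt0 ?powR_gt0.
have da := is_deriveD (is_derive_id v 1) (is_derive_hypot v).
have dp := is_derive1_comp (is_derive1_powR s (a0 : 0 < (id + hypot) v)) da.
have dn := is_deriveD dp (is_derive_cst (delta `^ s) v 1).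
have dV := is_deriveN (is_deriveV (lt0r_neq0
  (n0 : 0 < (((powR (R:=R))^~ s \o (id + hypot)) + cst (delta `^ s)) v)) dn).
apply: is_derive_eq dV _.
rewrite -[(_ + cst _) v]/((v + hypot v) `^ s + delta `^ s) /GRing.scale /=.
rewrite -[(id + hypot) v]/(v + hypot v) powRB ?(gt_eqF a0) ?implybT// powRr1 ?(ltW a0)//.
by field; rewrite !gt_eqF.
Qed.

(** With A = (v + q)^s, B = (q - v)^s, E = delta^s, one has A B = E^2, hence (A + E)^2 <= 2 A^2 + 2
    E^2 = 2 A (A + B). Both A and B are at most 2^s q^s, so a factor A cancels and the bound no
    longer sees the sign of v. *)
Lemma smoothed_sign_deriv_ge v : hypot v `^ (- (s + 1)) <=
  4 * 2 `^ s / s *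
  (s * (v + hypot v) `^ s / (hypot v * ((v + hypot v) `^ s + delta `^ s) ^+ 2)).
Proof.
have a0 := hypot_addl_gt0 v; have b0 := hypot_subr_gt0 v; have q0 := hypot_gt0 v.
set q := hypot v in a0 b0 q0 *.
set A := (v + q) `^ s; set B := (q - v) `^ s; set E := delta `^ s; set Q := q `^ s.
have A0 : 0 < A by rewrite powR_gt0.
have B0 : 0 < B by rewrite powR_gt0.
have E0 : 0 < E by rewrite powR_gt0.
have Q0 : 0 < Q by rewrite powR_gt0.
have two0 : 0 < 2 `^ s :> R by rewrite powR_gt0.
have AB : A * B = E ^+ 2.
  rewrite /A /B /E -powRM ?(ltW a0) ?(ltW b0)// expr2 -powRM ?(ltW delta0)//.
  congr (_ `^ s); have := sqr_hypot v; rewrite -/q => qE.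
  rewrite (_ : (v + q) * (q - v) = q ^+ 2 - v ^+ 2); last ring.
  rewrite qE; ring.
have le2 x : 0 < x -> x <= 2 * q -> x `^ s <= 2 `^ s * Q.
  move=> x0 xq; rewrite -powRM ?(ltW q0)//.
  by apply: ge0_ler_powR; rewrite ?nnegrE ?(ltW s0) ?(ltW x0)// mulr_ge0// ltW.
have vq := normr_lt_hypot v; rewrite -/q in vq.
have AQ : A <= 2 `^ s * Q.
  by apply: le2 => //; have := ler_norm v; lra.
have BQ : B <= 2 `^ s * Q.
  by apply: le2 => //; have := ler_norm (- v); rewrite normrN; lra.
have -> : q `^ (- (s + 1)) = (q * Q)^-1.
  by rewrite powRN powRD ?(gt_eqF q0) ?implybT// powRr1 ?(ltW q0)// mulrC.
have -> : 4 * 2 `^ s / s * (s * A / (q * (A + E) ^+ 2)) =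
    (4 * 2 `^ s * A) / (q * (A + E) ^+ 2).
  by field; rewrite !gt_eqF ?addr_gt0.
rewrite ler_pdivlMr ?mulr_gt0 ?exprn_gt0 ?addr_gt0// mulrC ler_pdivrMr ?mulr_gt0//.
rewrite (_ : _ * (q * Q) = q * (4 * 2 `^ s * A * Q)); last ring.
rewrite ler_wpM2l ?(ltW q0)//.
apply: (@le_trans _ _ (2 * A ^+ 2 + 2 * (A * B))).
  rewrite AB; have := sqr_ge0 (A - E); nra.
have -> : 2 * A ^+ 2 + 2 * (A * B) = A * (2 * A + 2 * B) by ring.
rewrite (_ : _ * Q = A * (4 * (2 `^ s * Q))); last ring.
by rewrite ler_wpM2l ?(ltW A0)//; lra.
Qed.

Lemma smoothed_sign_le0 v : smoothed_sign v <= 0.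
Proof. by rewrite oppr_le0 invr_ge0 addr_ge0 ?powR_ge0. Qed.

Lemma smoothed_sign_ge v : - delta `^ (- s) <= smoothed_sign v.
Proof.
rewrite lerN2 powRN lef_pV2 ?posrE ?powR_gt0//; first by rewrite lerDr powR_ge0.
by rewrite ltr_wpDl ?powR_ge0// powR_gt0.
Qed.

End smoothed_sign.

(** * Integral of the majorant over the circle *)

Section integral_bounds.
Context {R : realType}.
Let leb := @lebesgue_measure R.
Implicit Types (a b c t : R).

Lemma le_integral_derive (K f F : R -> R) a b : a < b ->
  measurable_fun setT K -> continuous f ->
  (forall t, is_derive t 1 F (f t)) ->
  (forall t, a <= t <= b -> 0 <= K t <= f t) ->
  (\int[leb]_(t in `[a, b]) (K t)%:E <= (F b - F a)%:E)%E.
Proof.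
move=> ab mK cf dF Kf.
have cF : continuous F.
  by move=> t; apply/differentiable_continuous/derivable1_diffP; case: (dF t).
rewrite EFinB -(@continuous_FTC2 _ f F a b)//.
- apply: ge0_le_integral => //=.
  + by move=> t; rewrite in_itv /= => /Kf/andP[K0 _]; rewrite lee_fin.
  + by apply/measurable_EFinP; exact: measurable_funTS.
  + apply/measurable_EFinP; apply: measurable_funTS.
    exact: continuous_measurable_fun.
  + by move=> t; rewrite in_itv /= => /Kf/andP[_]; rewrite lee_fin.
- exact: continuous_subspaceT.
- split.
  + by move=> t _; case: (dF t).
  + by apply: cvg_at_right_filter; exact: cF.
  + by apply: cvg_at_left_filter; exact: cF.
- by move=> t _; rewrite derive1E; case: (dF t).
Qed.

(** An inequality suffices and lets both pieces be closed: counting the point c twice can only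
    increase the right-hand side. *)
Lemma ge0_integral_itv_split (f : R -> \bar R) a c b : a <= c -> c <= b ->
  measurable_fun setT f -> (forall t, 0 <= f t)%E ->
  (\int[leb]_(t in `[a, b]) f t <=
   \int[leb]_(t in `[a, c]) f t + \int[leb]_(t in `[c, b]) f t)%E.
Proof.
move=> ac cb mf f0.
rewrite (@itv_bndbnd_setU _ _ (BLeft a) (BRight c) (BRight b)) ?bnd_simp//.
rewrite ge0_integral_setU//=; last 2 first.
- exact: measurable_funTS.
- apply/disj_setPRL => t /=; rewrite !in_itv /= => /andP[ct _]; apply/negP.
  by rewrite negb_and orbC -ltNge ct.
rewrite leeD2l//; apply: ge0_subset_integral => //=; first exact: measurable_funTS.
by apply: subset_itvr; rewrite bnd_simp.
Qed.

End integral_bounds.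

Lemma ler_dist_Nitv {R : realDomainType} (m x y : R) :
  - m <= x <= 0 -> - m <= y <= 0 -> `|x - y| <= m.
Proof.
move=> /andP[mx x0] /andP[my y0]; rewrite ler_norml; apply/andP; split; lra.
Qed.

Lemma normr_sum_ge1 {R : realDomainType} (x y : R) : x ^+ 2 + y ^+ 2 = 1 -> 1 <= `|y| + `|x|.
Proof.
rewrite -(real_normK (num_real x)) -(real_normK (num_real y)).
have := normr_ge0 x; have := normr_ge0 y; nra.
Qed.

(** * The integral of |e^(it) - z|^(-(s+1)) over the four quarters of the circle *)

Section circle_kernel.
Context {R : realType}.
Variables (s : R) (z : R[i]).
Hypotheses (s0 : 0 < s) (z1 : cabs z < 1).

Let delta := 1 - cabs z.
Let delta0 : 0 < delta. Proof. by rewrite subr_gt0. Qed.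

Definition kernel_dist (t : R) := cabs (1 - z * (expi t)^*).

Lemma cabs_expi (t : R) : cabs (expi t) = 1.
Proof. by rewrite /cabs /expi /= cos2Dsin2 sqrtr1. Qed.

Lemma kernel_distE t : kernel_dist t = cabs (expi t - z).
Proof.
rewrite -[LHS]mulr1 -(cabs_expi t) /kernel_dist -cabsM mulrBl mul1r -mulrA.
by rewrite (mulrC _^*) mulJc cabs_expi expr1n mulr1.
Qed.

Lemma kernel_dist_ge t : delta <= kernel_dist t.
Proof.
rewrite /kernel_dist (le_trans _ (one_sub_cabs_le _))// cabsM cabsJ cabs_expi.
by rewrite mulr1.
Qed.

(** Both [delta] and |cos t - Re z| are at most the distance, so [hypot] is at most sqrt 2 times it;
    2 is a convenient larger factor. *)
Lemma hypot_Re_le t : hypot delta (cos t - Re z) <= 2 * kernel_dist t.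
Proof.
have g0 : 0 < kernel_dist t by exact: lt_le_trans (kernel_dist_ge t).
rewrite -(@ler_pXn2r _ 2)// ?nnegrE ?mulr_ge0 ?(ltW g0) ?(ltW (hypot_gt0 _ _))//.
rewrite sqr_hypot; have := kernel_dist_ge t.
have : (cos t - Re z) ^+ 2 <= kernel_dist t ^+ 2.
  rewrite -real_normK ?num_real// lerXn2r ?nnegrE ?(ltW g0)//.
  by rewrite kernel_distE (le_trans _ (ler_Re_cabs _))// ReD ReN.
have := delta0; nra.
Qed.

Lemma hypot_Im_le t : hypot delta (sin t - Im z) <= 2 * kernel_dist t.
Proof.
have g0 : 0 < kernel_dist t by exact: lt_le_trans (kernel_dist_ge t).
rewrite -(@ler_pXn2r _ 2)// ?nnegrE ?mulr_ge0 ?(ltW g0) ?(ltW (hypot_gt0 _ _))//.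
rewrite sqr_hypot; have := kernel_dist_ge t.
have : (sin t - Im z) ^+ 2 <= kernel_dist t ^+ 2.
  rewrite -real_normK ?num_real// lerXn2r ?nnegrE ?(ltW g0)//.
  by rewrite kernel_distE (le_trans _ (ler_Im_cabs _))// ImD ImN.
have := delta0; nra.
Qed.

Let K t := kernel_dist t `^ (- (s + 1)).
Let h v := s * (v + hypot delta v) `^ s /
  (hypot delta v * ((v + hypot delta v) `^ s + delta `^ s) ^+ 2).
(** The first factor pays for the 2 in [hypot_Re_le] and [hypot_Im_le], the second is the constant
    of [smoothed_sign_deriv_ge]. *)
Let c := 2 `^ (s + 1) * (4 * 2 `^ s / s).

Let c_ge0 : 0 <= c.
Proof. by rewrite /c mulr_ge0 ?divr_ge0 ?mulr_ge0 ?powR_ge0 ?(ltW s0). Qed.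

Let K_le v t : hypot delta v <= 2 * kernel_dist t -> K t <= c * h v.
Proof.
move=> hv; have q0 := hypot_gt0 delta0 v.
have g0 : 0 < kernel_dist t by exact: lt_le_trans (kernel_dist_ge t).
rewrite /c -mulrA.
rewrite (le_trans _ (ler_wpM2l (powR_ge0 _ _) (smoothed_sign_deriv_ge delta0 s0 v)))//.
rewrite /K !powRN -[leRHS]invrK invfM invrK lef_pV2 ?posrE ?mulr_gt0 ?invr_gt0 ?powR_gt0//.
rewrite ler_pdivrMl ?powR_gt0// -powRM ?(ltW g0)//.
apply: ge0_ler_powR; rewrite ?nnegrE ?(ltW q0) ?mulr_ge0 ?(ltW g0) ?addr_ge0 ?(ltW s0)//.
Qed.

Let K_ge0 t : 0 <= K t. Proof. exact: powR_ge0. Qed.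

Let K_le_trig t : K t <= c * (`|sin t| * h (cos t - Re z) + `|cos t| * h (sin t - Im z)).
Proof.
have h1 := K_le (hypot_Re_le t); have h2 := K_le (hypot_Im_le t).
have sc := normr_sum_ge1 (cos2Dsin2 t).
have := K_ge0 t => k0.
apply: (@le_trans _ _ ((`|sin t| + `|cos t|) * K t)); first by rewrite ler_peMl.
rewrite mulrDl mulrDr; apply: lerD; rewrite [leRHS]mulrCA.
  exact: ler_wpM2l h1.
exact: ler_wpM2l h2.
Qed.

Lemma measurable_kernel_dist : measurable_fun setT kernel_dist.
Proof.
apply: cmeasurable_cabs; apply: is_cderive_measurable => t.
exists (0 - z * ('i * expi t)^*).
exact: is_cderiveB (is_cderive_cst _ _) (is_cderiveZ _ (is_cderiveJ (is_cderive_expi t))).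
Qed.

Let mK : measurable_fun setT K.
Proof. exact: measurableT_comp (measurable_powR _) measurable_kernel_dist. Qed.

Let h_continuous : continuous h.
Proof.
have dcont (f : R -> R) : (forall v : R, exists d : R, is_derive v 1 f d) -> continuous f.
  by move=> df v; apply/differentiable_continuous/derivable1_diffP; case: (df v) => d [].
have qc : continuous (hypot delta).
  by apply: dcont => v; exists (v / hypot delta v); exact: is_derive_hypot.
have pc : continuous (fun v => (v + hypot delta v) `^ s).
  apply: dcont => v; eexists.
  have a0 := hypot_addl_gt0 delta0 v.
  exact: is_derive1_comp (is_derive1_powR s (a0 : 0 < (id + hypot delta) v))
    (is_deriveD (is_derive_id v 1) (is_derive_hypot delta0 v)).
move=> v; apply: cvgM; first by apply: cvgM; [exact: cvg_cst|exact: pc].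
apply: cvgV.
  rewrite mulf_neq0 ?expf_neq0 ?gt_eqF ?hypot_gt0//.
  by rewrite addr_gt0 ?powR_gt0// hypot_addl_gt0.
apply: cvgM; first exact: qc.
by apply: cvgM; apply: cvgD; [exact: pc|exact: cvg_cst|exact: pc|exact: cvg_cst].
Qed.

(** [sg] and [tu] are the constant signs of sin and cos on the interval. As [smoothed_sign] takes
    values in [- delta^(-s), 0], each of the two terms of the primitive varies by at most
    delta^(-s). *)
Let quarter_bound (sg tu a b : R) : a < b -> `|sg| <= 1 -> `|tu| <= 1 ->
  (forall t, a <= t <= b -> `|sin t| = sg * sin t) ->
  (forall t, a <= t <= b -> `|cos t| = tu * cos t) ->
  (\int[lebesgue_measure]_(t in `[a, b]) (K t)%:E <= (c * (2 * delta `^ (- s)))%:E)%E.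
Proof.
move=> ab sg1 tu1 sgE tuE; set H := smoothed_sign delta s.
(* The sign of [sg] is reversed because the derivative of cos is - sin. *)
pose F t := c * (- sg * H (cos t - Re z) + tu * H (sin t - Im z)).
pose f t := c * (sg * sin t * h (cos t - Re z) + tu * cos t * h (sin t - Im z)).
have HB (x v w : R) : `|x| <= 1 -> x * H v - x * H w <= delta `^ (- s).
  move=> x1; rewrite -mulrBr (le_trans (ler_norm _))// normrM -[leRHS]mul1r.
  by rewrite ler_pM// ler_dist_Nitv ?smoothed_sign_le0 ?smoothed_sign_ge.
have -> : c * (2 * delta `^ (- s)) = c * (delta `^ (- s) + delta `^ (- s)) by ring.
apply: (@le_trans _ _ (F b - F a)%:E).
  apply: (@le_integral_derive R K f F a b ab mK).
  - move=> t; apply: cvgM; first exact: cvg_cst.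
    have cb : {for t, continuous (fun x => cos x - Re z)}.
      by apply: cvgB; [exact: continuous_cos|exact: cvg_cst].
    have sb : {for t, continuous (fun x => sin x - Im z)}.
      by apply: cvgB; [exact: continuous_sin|exact: cvg_cst].
    apply: cvgD; apply: cvgM.
    + by apply: cvgM; [exact: cvg_cst|exact: continuous_sin].
    + exact: (@continuous_comp _ _ _ (fun x => cos x - Re z) h t cb (@h_continuous _)).
    + by apply: cvgM; [exact: cvg_cst|exact: continuous_cos].
    + exact: (@continuous_comp _ _ _ (fun x => sin x - Im z) h t sb (@h_continuous _)).
  - move=> t.
    have dc := is_derive1_comp (is_derive_smoothed_sign s delta0 ((cos - cst (Re z)) t))
       (is_deriveB (is_derive_cos t) (is_derive_cst (Re z) t 1)).
    have ds := is_derive1_comp (is_derive_smoothed_sign s delta0 ((sin - cst (Im z)) t))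
       (is_deriveB (is_derive_sin t) (is_derive_cst (Im z) t 1)).
    apply: is_derive_eq (is_deriveZ c
      (is_deriveD (is_deriveZ (- sg) dc) (is_deriveZ tu ds))) _.
    rewrite /GRing.scale /= /f.
    rewrite -[(cos - cst (Re z)) t]/(cos t - Re z) -[(sin - cst (Im z)) t]/(sin t - Im z).
    rewrite -!/(h _) !subr0; move: (h (cos t - Re z)) (h (sin t - Im z)) => p q; ring.
  - by move=> t tab; rewrite K_ge0 /= /f -sgE// -tuE// K_le_trig.
rewrite lee_fin /F -mulrBr ler_wpM2l//.
have := HB (- sg) (cos b - Re z) (cos a - Re z); rewrite normrN => /(_ sg1).
have := HB tu (sin b - Im z) (sin a - Im z) tu1.
move: (H _) (H _) (H (_ - Re z)) (H (_ - Re z)) (_ `^ _) => p1 p2 p3 p4 d.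
lra.
Qed.

Lemma integral_kernel_le :
  (\int[angle_measure]_t (kernel_dist t `^ (- (s + 1)))%:E <=
   (8 * c / (2 * pi) * delta `^ (- s))%:E)%E.
Proof.
have p0 := pi_gt0 R.
rewrite integral_uniform; last 2 first.
- by apply/measurable_EFinP; exact: mK.
- by move=> t; rewrite lee_fin powR_ge0.
rewrite subr0.
(* 8 is four quarters times the 2 of [quarter_bound]. *)
have -> : 8 * c / (2 * pi) * delta `^ (- s) = (2 * pi)^-1 * (4 * (c * (2 * delta `^ (- s)))).
  by ring.
rewrite EFinM lee_pmul2l//; last by rewrite lte_fin invr_gt0 twopi_gt0.
have m1 : measurable_fun setT (EFin \o K) by exact/measurable_EFinP.
have k0 t : (0 <= (EFin \o K) t)%E by rewrite lee_fin powR_ge0.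
have l1 : 0 <= pi / 2 :> R by lra.
have l2 : pi / 2 <= pi :> R by lra.
have l3 : pi <= pi + pi / 2 :> R by lra.
have l4 : pi + pi / 2 <= 2 * pi :> R by lra.
rewrite (le_trans (ge0_integral_itv_split (le_trans l1 l2) (le_trans l3 l4) m1 k0))//.
set B := c * _.
have -> : (4 * B)%:E = ((B%:E + B%:E) + (B%:E + B%:E))%E by rewrite -!EFinD; congr EFin; ring.
have sP t : 0 <= t <= pi -> `|sin t| = 1 * sin t.
  by move=> ?; rewrite ger0_norm ?mul1r// sin_ge0_pi.
have sN t : pi <= t <= 2 * pi -> `|sin t| = -1 * sin t.
  move=> /andP[ta tb]; rewrite mulN1r -[t](subrK pi) sinDpi normrN ger0_norm ?opprK//.
  by apply: sin_ge0_pi; lra.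
have cP t : - (pi / 2) <= t <= pi / 2 -> `|cos t| = 1 * cos t.
  by move=> ?; rewrite ger0_norm ?mul1r// cos_ge0_pihalf.
have cN t : pi / 2 <= t <= pi + pi / 2 -> `|cos t| = -1 * cos t.
  move=> /andP[ta tb]; rewrite mulN1r -[t](subrK pi) cosDpi normrN ger0_norm ?opprK//.
  by apply: cos_ge0_pihalf; lra.
have cP2 t : pi + pi / 2 <= t <= 2 * pi -> `|cos t| = 1 * cos t.
  move=> /andP[ta tb]; rewrite -[t](subrK pi) cosDpi normrN cN; last by lra.
  by rewrite mulN1r mul1r.
have n1 : `|1 : R| <= 1 by rewrite normr1.
have nN1 : `|-1 : R| <= 1 by rewrite normrN1.
apply: leeD.
  rewrite (le_trans (ge0_integral_itv_split l1 l2 m1 k0))//; apply: leeD.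
    apply: (quarter_bound _ n1 n1); first lra.
    + by move=> t /andP[ta tb]; apply: sP; lra.
    + by move=> t /andP[ta tb]; apply: cP; lra.
  apply: (quarter_bound _ n1 nN1); first lra.
  + by move=> t /andP[ta tb]; apply: sP; lra.
  + by move=> t /andP[ta tb]; apply: cN; lra.
rewrite (le_trans (ge0_integral_itv_split l3 l4 m1 k0))//; apply: leeD.
  apply: (quarter_bound _ nN1 nN1); first lra.
  + by move=> t /andP[ta tb]; apply: sN; lra.
  + by move=> t /andP[ta tb]; apply: cN; lra.
apply: (quarter_bound _ nN1 n1); first lra.
+ by move=> t /andP[ta tb]; apply: sN; lra.
+ by move=> t /andP[ta tb]; apply: cP2; lra.
Qed.

End circle_kernel.

(** * Weighted integrals of functions in L^p *)

Section weighted_bound.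
Context d (T : measurableType d) (R : realType) (P : probability T R).

(** Above the height t, write a = a^(1 - p) a^p and use that 1 - p <= 0. *)
Lemma ler_powR_truncate (p t a : R) : 1 <= p -> 0 < t -> 0 <= a ->
  a <= t `^ (1 - p) * a `^ p + t.
Proof.
move=> p1 t0 a0; have [at_|ta] := leP a t.
  by rewrite (le_trans at_)// lerDr mulr_ge0 ?powR_ge0.
have a1 : 0 < a by exact: lt_trans ta.
rewrite -[leLHS]addr0 lerD// ?(ltW t0)//.
rewrite -{1}[a]powRr1 ?(ltW a1)// -{1}(addrNK p 1) powRD ?(gt_eqF a1) ?implybT//.
rewrite ler_wpM2r ?powR_ge0// -(opprB p 1) !powRN lef_pV2 ?posrE ?powR_gt0//.
by apply: ge0_ler_powR; rewrite ?nnegrE ?subr_ge0 ?(ltW a1) ?(ltW t0) ?(ltW ta).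
Qed.

Variables (F : T -> R) (k : T -> R) (A D : R).
Hypotheses (A0 : 0 <= A) (D0 : 0 < D).
Hypotheses (mF : measurable_fun setT F) (F0 : forall x, 0 <= F x).
Hypotheses (mk : measurable_fun setT k) (k0 : forall x, 0 <= k x).
Hypotheses (kS : forall x, k x <= A / D ^+ 2).
Hypotheses (kI : (\int[P]_x (k x)%:E <= (A / D)%:E)%E).

Let weighted_bound_y : (Lnorm P +oo (EFin \o F) < +oo)%E ->
  (\int[P]_x (k x * F x)%:E <= (A / D * fine (Lnorm P +oo (EFin \o F)))%:E)%E.
Proof.
(* The norm at [+oo] is the essential supremum only under this positivity condition. *)
have PT : (0 < P [set: T])%E by rewrite probability_setT.
move=> Noo; have N0 := Lnorm_ge0 P +oo (EFin \o F).
have Nf : Lnorm P +oo (EFin \o F) \is a fin_num by rewrite ge0_fin_numE.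
set N := fine _; have n0 : 0 <= N by rewrite fine_ge0.
have FN : {ae P, forall x, ((F x)%:E <= N%:E)%E}.
  have := ess_sup_inf.ess_sup_ge P (abse \o (EFin \o F)).
  apply: filterS => x /= ; rewrite ger0_norm// => /le_trans; apply.
  by rewrite /N fineK// unlock /= PT.
apply: (@le_trans _ _ (\int[P]_x (N%:E * (k x)%:E))%E).
  apply: ae_ge0_le_integral => //=.
  - by move=> x _; rewrite lee_fin mulr_ge0.
  - by apply/measurable_EFinP; exact: measurable_funM.
  - by move=> x _; rewrite mule_ge0// lee_fin.
  - by apply/measurable_EFinP; exact: measurable_funM.
  - by apply: filterS FN => x; rewrite lee_fin => FxN _; rewrite lee_fin mulrC ler_wpM2r.
rewrite ge0_integralZl//=.
- by rewrite mulrC EFinM lee_wpmul2l// lee_fin.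
- exact/measurable_EFinP.
- by move=> x _; rewrite lee_fin.
Qed.

Let weighted_bound_fin (p : R) : 1 <= p -> (Lnorm P p%:E (EFin \o F) < +oo)%E ->
  (\int[P]_x (k x * F x)%:E <=
   (2 * A / D `^ (1 + p^-1) * fine (Lnorm P p%:E (EFin \o F)))%:E)%E.
Proof.
move=> p1 Noo; have N0 := Lnorm_ge0 P p%:E (EFin \o F).
have p0 : 0 < p by exact: lt_le_trans p1.
have Nf : Lnorm P p%:E (EFin \o F) \is a fin_num by rewrite ge0_fin_numE.
have NE := poweR_Lnorm P (EFin \o F) (lt0r_neq0 p0).
rewrite -(fineK Nf) poweR_EFin in NE.
set N := fine _ in NE *; have n0 : 0 <= N by rewrite fine_ge0.
set G := D `^ (1 + p^-1); have G0 : 0 < G by rewrite powR_gt0.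
(* [N] may be 0 while the truncation height must be positive; the bound is proved for every [N']
   above [N] and the slack removed at the end. *)
have main N' : N < N' -> (\int[P]_x (k x * F x)%:E <= (2 * A / G * N')%:E)%E.
  move=> NN'; have N'0 : 0 < N' by exact: le_lt_trans NN'.
  (* At this height the contribution [E1] of the L^1 bound on [k] equals the contribution [E2] of
     its pointwise bound. *)
  pose t := N' * D `^ (- p^-1).
  have t0 : 0 < t by rewrite mulr_gt0 ?powR_gt0.
  have E1 : A / D * t = A / G * N'.
    rewrite /t /G powRN powRD ?(gt_eqF D0) ?implybT// powRr1 ?(ltW D0)//.
    by field; rewrite !gt_eqF ?powR_gt0.
  have E2 : A / D ^+ 2 * t `^ (1 - p) * N' `^ p = A / G * N'.
    rewrite /t powRM ?(ltW N'0) ?powR_ge0// -powRrM.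
    have -> : A / D ^+ 2 * (N' `^ (1 - p) * D `^ (- p^-1 * (1 - p))) * N' `^ p =
      A * (N' `^ (1 - p) * N' `^ p) * (D `^ (- p^-1 * (1 - p)) * D ^- 2) by ring.
    rewrite -powRD ?(gt_eqF N'0) ?implybT// subrK powRr1 ?(ltW N'0)//.
    rewrite -(powR_invn 2 (ltW D0)) -powRD ?(gt_eqF D0) ?implybT//.
    have -> : - p^-1 * (1 - p) + - 2%:R = - (1 + p^-1) by field; rewrite gt_eqF.
    by rewrite powRN -/G; ring.
  pose f1 x := A / D ^+ 2 * t `^ (1 - p) * F x `^ p.
  have f10 x : 0 <= f1 x.
    by rewrite mulr_ge0 ?powR_ge0// mulr_ge0 ?powR_ge0// divr_ge0// ltW ?exprn_gt0.
  have mf1 : measurable_fun setT f1.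
    by apply: measurable_funM => //; exact: measurableT_comp (measurable_powR _) mF.
  apply: (@le_trans _ _ (\int[P]_x ((f1 x)%:E + t%:E * (k x)%:E))%E).
    apply: ge0_le_integral => //=.
    - by move=> x _; rewrite lee_fin mulr_ge0.
    - by apply/measurable_EFinP; exact: measurable_funM.
    - by apply: emeasurable_funD; apply/measurable_EFinP => //; exact: measurable_funM.
    - move=> x _; rewrite lee_fin.
      apply: (le_trans (ler_wpM2l (k0 x) (ler_powR_truncate p1 t0 (F0 x)))).
      rewrite mulrDr [X in _ + X]mulrC lerD2r /f1.
      by rewrite -[leRHS]mulrA ler_wpM2r// mulr_ge0 ?powR_ge0.
  rewrite ge0_integralD//=; last 4 first.
  - by move=> x _; rewrite lee_fin.
  - exact/measurable_EFinP.
  - by move=> x _; rewrite mule_ge0// lee_fin// ltW.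
  - by apply/measurable_EFinP; exact: measurable_funM.
  rewrite (_ : 2 * A / G * N' = A / G * N' + A / G * N'); last ring.
  rewrite EFinD; apply: leeD.
    rewrite -E2.
    have -> : (\int[P]_x (f1 x)%:E =
        (A / D ^+ 2 * t `^ (1 - p))%:E * \int[P]_x (F x `^ p)%:E)%E.
      rewrite -ge0_integralZl//=.
      - by apply/measurable_EFinP; exact: measurableT_comp (measurable_powR _) mF.
      - by move=> x _; rewrite lee_fin powR_ge0.
      - by rewrite lee_fin mulr_ge0 ?powR_ge0// divr_ge0// ltW ?exprn_gt0.
    have -> : (\int[P]_x (F x `^ p)%:E = (N `^ p)%:E)%E.
      rewrite NE; apply: eq_integral => x _ /=.
      by rewrite ger0_norm// -poweR_EFin.
    rewrite -EFinM lee_fin ler_wpM2l//.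
      by rewrite mulr_ge0 ?powR_ge0// divr_ge0// ltW ?exprn_gt0.
    by apply: ge0_ler_powR; rewrite ?nnegrE ?(ltW p0) ?(ltW N'0) ?(ltW NN').
  rewrite ge0_integralZl//=; last 3 first.
  - exact/measurable_EFinP.
  - by move=> x _; rewrite lee_fin.
  - by rewrite lee_fin ltW.
  rewrite -E1 (mulrC _ t) EFinM; apply: lee_wpmul2l kI.
  by rewrite lee_fin ltW.
apply/lee_addgt0Pr => e e0; rewrite -EFinD.
pose q := 2 * A / G; have q0 : 0 <= q by rewrite /q divr_ge0 ?mulr_ge0 ?(ltW G0).
have q1 : 0 < q + 1 by rewrite ltr_wpDl.
have h : 0 < e / (q + 1) by rewrite divr_gt0.
apply: (le_trans (main (N + e / (q + 1)) _)); first by rewrite ltrDl.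
rewrite lee_fin -/q mulrDr lerD2l mulrA ler_pdivrMr//.
by rewrite mulrC ler_wpM2l ?(ltW e0)// lerDl.
Qed.

Lemma weighted_bound (p : \bar R) : (1 <= p)%E -> (Lnorm P p (EFin \o F) < +oo)%E ->
  (\int[P]_x (k x * F x)%:E <=
   (2 * A / D `^ (1 + fine p^-1) * fine (Lnorm P p (EFin \o F)))%:E)%E.
Proof.
case: p => [p|_ Noo|//].
  by rewrite lee_fin fine_invr; exact: weighted_bound_fin.
apply: (le_trans (weighted_bound_y Noo)).
rewrite invey /= addr0 powRr1 ?(ltW D0)// lee_fin ler_wpM2r ?fine_ge0 ?Lnorm_ge0//.
by rewrite ler_wpM2r ?invr_ge0 ?(ltW D0)// mulr_natl mulr2n lerDl.
Qed.

End weighted_bound.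

(** * Complex integrals and real differentiability *)

Section complex_integral.
Context {R : realType}.
Let mu : {measure set _ -> \bar R} := @angle_measure R.
Implicit Types (f g k : R -> R[i]) (M a : R).

Definition cintegrable f := mu.-integrable setT (EFin \o (fun t => Re (f t))) /\
  mu.-integrable setT (EFin \o (fun t => Im (f t))).

(** The integral is defined by coordinates, so each is bounded by M separately; hence the factor
    2. *)
Lemma cintegral_cabs_le f (h : R -> R) M : cmeasurable f -> measurable_fun setT h ->
  (forall t, cabs (f t) <= h t) -> (\int[mu]_t (h t)%:E <= M%:E)%E ->
  cintegrable f /\ cabs (cintegral mu setT f) <= 2 * M.
Proof.
move=> [mr mi] mh fh hM.
have part (g : R -> R) : measurable_fun setT g -> (forall t, `|g t| <= cabs (f t)) ->
    mu.-integrable setT (EFin \o g) /\ `|\int[mu]_t g t| <= M.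
  move=> mg gf.
  have gM : (\int[mu]_t `|(g t)%:E| <= M%:E)%E.
    apply: le_trans hM; apply: ge0_le_integral => //=.
    - by apply/measurable_EFinP; exact: measurableT_comp mg.
    - exact/measurable_EFinP.
    - by move=> t _; rewrite lee_fin (le_trans (gf t)).
  have ig : mu.-integrable setT (EFin \o g).
    apply/integrableP; split; first exact/measurable_EFinP.
    by rewrite (le_lt_trans gM)// ltry.
  split=> //; rewrite -lee_fin EFin_normr_Rintegral// (le_trans _ gM)//.
  by apply: le_abse_integral => //; exact/measurable_EFinP.
have [ir hr] := part _ mr (fun t => ler_Re_cabs (f t)).
have [ii hi] := part _ mi (fun t => ler_Im_cabs (f t)).
split=> //; rewrite (le_trans (cabs_le_ReIm _))//=.
by rewrite mulr_natl mulr2n lerD.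
Qed.

Lemma cintegralD f g : cintegrable f -> cintegrable g ->
  cintegral mu setT (fun t => f t + g t) = cintegral mu setT f + cintegral mu setT g.
Proof.
move=> [fr fi] [gr gi]; rewrite /cintegral; simpc; congr (_ +i* _).
- by under eq_Rintegral do rewrite ReD; rewrite RintegralD.
- by under eq_Rintegral do rewrite ImD; rewrite RintegralD.
Qed.

Lemma cintegralZ a f : cintegrable f ->
  cintegral mu setT (fun t => a%:C * f t) = a%:C * cintegral mu setT f.
Proof.
move=> [fr fi]; rewrite /cintegral; simpc; congr (_ +i* _).
- under eq_Rintegral do rewrite ReM /= mul0r subr0.
  by rewrite RintegralZl.
- under eq_Rintegral do rewrite ImM /= mul0r addr0.
  by rewrite RintegralZl.
Qed.

Lemma cintegrableZ a f : cintegrable f -> cintegrable (fun t => a%:C * f t).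
Proof.
move=> [fr fi]; split.
- apply: eq_integrable (integrableZl measurableT a fr) => // t _ /=.
  by rewrite ReM /= mul0r subr0 EFinM.
- apply: eq_integrable (integrableZl measurableT a fi) => // t _ /=.
  by rewrite ImM /= mul0r addr0 EFinM.
Qed.

Lemma cintegrableD f g : cintegrable f -> cintegrable g -> cintegrable (fun t => f t + g t).
Proof.
move=> [fr fi] [gr gi]; split.
- by apply: eq_integrable (integrableD measurableT fr gr) => // t _ /=; rewrite ReD EFinD.
- by apply: eq_integrable (integrableD measurableT fi gi) => // t _ /=; rewrite ImD EFinD.
Qed.

Lemma cintegralB f g : cintegrable f -> cintegrable g ->
  cintegral mu setT (fun t => f t - g t) = cintegral mu setT f - cintegral mu setT g.
Proof.
move=> cf cg; have cg' := cintegrableZ (-1) cg.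
rewrite -[in RHS]mulN1r -[X in _ + X * _](rmorphN1 (real_complex R)).
rewrite -cintegralZ// -cintegralD//.
by congr cintegral; apply/funext => t; rewrite rmorphN1 mulN1r.
Qed.

Lemma cintegrableB f g : cintegrable f -> cintegrable g -> cintegrable (fun t => f t - g t).
Proof.
move=> cf cg; rewrite (_ : (fun _ => _) = fun t => f t + (-1)%:C * g t).
  exact/cintegrableD/cintegrableZ.
by apply/funext => t; rewrite rmorphN1 mulN1r.
Qed.

End complex_integral.

Lemma diff_of_quadratic_expansion {K : realFieldType} (V W : normedModType K) (f : V -> W)
    (df : {linear V -> W}) (x : V) (M eta : K) : continuous df -> 0 < eta ->
  (forall v, `|v| <= eta -> `|f (v + x) - f x - df v| <= M * `|v| ^+ 2) ->
  differentiable f x /\ 'd f x = df :> (V -> W).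
Proof.
move=> cdf eta0 fM; have M0 : 0 < `|M| + 1 by rewrite ltr_wpDl.
have expansion : f \o shift x = (cst (f x) + df) +o_ 0 id.
  apply/eqaddoP => e e0; near=> v.
  rewrite -[(_ - _) v]/(f (v + x) - (f x + df v)) opprD addrA.
  (* Within this radius |M| |v|^2 <= e |v|; adding 1 avoids a division by zero. *)
  have : `|v| <= Num.min eta (e / (`|M| + 1)).
    by near: v; apply: nbhs0_le; rewrite lt_min eta0 divr_gt0.
  rewrite le_min ler_pdivlMr// => /andP[/fM fv ve]; apply: le_trans fv _.
  have := ler_norm M; have := normr_ge0 M; have := normr_ge0 v.
  move: ve; rewrite /=; move: `|v| `|M| => a b *; nra.
have dE := diff_unique cdf expansion.
by split=> //; apply/diff_locallyP; rewrite dE.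
Unshelve. all: by end_near. Qed.

Section real_derivative_criterion.
Context {R : realType}.
Implicit Types (f L : R[i] -> R[i]) (z h : R[i]).

(** The expansion is measured by the modulus, [differentiable] by the max norm. The modulus is at
    most twice the max norm, so the radius becomes [eta / 2] and the constant [4 * |M|]. *)
Lemma real_diff_of_expansion f L z (M eta : R) : 0 < eta ->
  (forall (a b : R) h k, L (a%:C * h + b%:C * k) = a%:C * L h + b%:C * L k) ->
  (forall h, cabs h <= eta -> cabs (f (z + h) - f z - L h) <= M * cabs h ^+ 2) ->
  real_differentiable f z /\ forall h, real_diff f z h = L h.
Proof.
move=> eta0 linL fL.
pose l (v : R * R) : R * R := pair_of_complex (L (complex_of_pair v)).
have l_lin : linear l.
  move=> a u v; rewrite /l.
  have -> : complex_of_pair (a *: u + v) = a%:C * complex_of_pair u + 1%:C * complex_of_pair v.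
    by case: u v => [u1 u2] [v1 v2]; rewrite /complex_of_pair /= /GRing.scale /=; simpc.
  by rewrite linL /pair_of_complex !(ReD, ImD, ReM, ImM) /= !(mul0r, subr0, addr0, mul1r).
pose dl : {linear (R * R)%type -> (R * R)%type} :=
  HB.pack l
    (GRing.isLinear.Build R (R * R)%type (R * R)%type *:%R l l_lin).
have lE : l = fun v => (v.1 * Re (L 1) + v.2 * Re (L 'i), v.1 * Im (L 1) + v.2 * Im (L 'i)).
  apply/funext => -[v1 v2]; rewrite /l.
  have -> : complex_of_pair (v1, v2) = v1%:C * 1 + v2%:C * 'i.
    by rewrite /complex_of_pair /=; simpc.
  by rewrite linL /pair_of_complex !(ReD, ImD, ReM, ImM) /= !(mul0r, subr0, addr0).
have cdl : continuous dl.
  suff : continuous l by [].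
  rewrite lE => v.
  have lin_cvg (a b : R) : (fun w : R * R => w.1 * a + w.2 * b) @ v --> v.1 * a + v.2 * b.
    by apply: cvgD; apply: cvgM; [exact: cvg_fst|exact: cvg_cst|exact: cvg_snd|exact: cvg_cst].
  exact: cvg_pair (lin_cvg _ _) (lin_cvg _ _).
have pairK (w : R[i]) : complex_of_pair (pair_of_complex w) = w by case: w.
have copD (u v : R * R) : complex_of_pair (u + v) = complex_of_pair u + complex_of_pair v.
  by case: u v => [? ?] [? ?].
have cabs_cop (v : R * R) : cabs (complex_of_pair v) <= 2 * `|v|.
  rewrite (le_trans (cabs_le_ReIm _))//= prod_normE /= mulr_natl mulr2n.
  by rewrite lerD// le_max lexx ?orbT.
have norm_poc (w : R[i]) : `|pair_of_complex w| <= cabs w.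
  by rewrite prod_normE /= ge_max ler_Re_cabs ler_Im_cabs.
have eta2 : 0 < eta / 2 by rewrite divr_gt0.
have expansion (v : (R * R)%type) : `|v| <= eta / 2 ->
    `|planar f (v + pair_of_complex z) - planar f (pair_of_complex z) - dl v| <=
    4 * `|M| * `|v| ^+ 2.
  move=> v_small.
  have -> : planar f (v + pair_of_complex z) - planar f (pair_of_complex z) - dl v =
      pair_of_complex (f (z + complex_of_pair v) - f z - L (complex_of_pair v)).
    rewrite /planar /= copD pairK [complex_of_pair v + z]addrC.
    by rewrite /dl /= /l /pair_of_complex !(ReD, ImD, ReN, ImN).
  rewrite (le_trans (norm_poc _))//.
  have hv : cabs (complex_of_pair v) <= eta.
    by rewrite (le_trans (cabs_cop v))// -ler_pdivlMl// mulrC.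
  rewrite (le_trans (fL _ hv))//.
  have sq : cabs (complex_of_pair v) ^+ 2 <= 4 * `|v| ^+ 2.
    rewrite (_ : 4 * _ = (2 * `|v|) ^+ 2); last ring.
    by apply: lerXn2r; rewrite ?nnegrE ?cabs_ge0 ?mulr_ge0.
  rewrite (le_trans (ler_wpM2r (sqr_ge0 _) (ler_norm M)))//.
  rewrite (le_trans (ler_wpM2l (normr_ge0 M) sq))//.
  by rewrite [4 * `|M|]mulrC mulrA.
have [df dE] := diff_of_quadratic_expansion cdl eta2 expansion.
split=> // h; rewrite /real_diff dE /= /l pairK.
by case: (h) => ? ?; rewrite /complex_of_pair /pair_of_complex /=; case: (L _).
Qed.

End real_derivative_criterion.

(** * Differentiation under the integral sign *)

Section poisson_derivative.
Context {R : realType}.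
Variables alpha beta : R[i].
Hypothesis hRe : -1 < Re alpha + Re beta.
Implicit Types (z h : R[i]) (t : R).

Let mu : {measure set _ -> \bar R} := @angle_measure R.
Let s := Re alpha + Re beta + 1.
Let s0 : 0 < s. Proof. by rewrite /s -ltrBlDr sub0r. Qed.
Let c := c_coef alpha beta.

Definition poisson_kernel z t := c * u_kernel alpha beta (z * (expi t)^*).

Definition poisson_dkernel z h t := c * (u_kernel alpha beta (z * (expi t)^*)
  * dlog_kernel alpha beta (z * (expi t)^*) (h * (expi t)^*)).

Let cabs_rot z t : cabs (z * (expi t)^*) = cabs z.
Proof. by rewrite cabsM cabsJ cabs_expi mulr1. Qed.

Let is_cderive_rot z t : is_cderive t (fun x => z * (expi x)^*) (z * ('i * expi t)^*).
Proof. exact: is_cderiveZ (is_cderiveJ (is_cderive_expi t)). Qed.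

Lemma cmeasurable_poisson_kernel z : cabs z < 1 -> cmeasurable (poisson_kernel z).
Proof.
move=> z1; apply: is_cderive_measurable => t.
have zt : cabs (z * (expi t)^*) < 1 by rewrite cabs_rot.
have du := is_cderive_u_kernel alpha beta zt (is_cderive_rot z t).
by eexists; exact: is_cderiveZ c du.
Qed.

Lemma cmeasurable_poisson_dkernel z h : cabs z < 1 -> cmeasurable (poisson_dkernel z h).
Proof.
move=> z1; apply: is_cderive_measurable => t.
have zt : cabs (z * (expi t)^*) < 1 by rewrite cabs_rot.
have du := is_cderive_u_kernel alpha beta zt (is_cderive_rot z t).
have [d [dd _]] := is_cderive_dlog_kernel alpha beta zt
  (is_cderive_rot z t) (is_cderive_rot h t).
by eexists; exact: is_cderiveZ c (is_cderiveM du dd).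
Qed.

Lemma poisson_dkernel_linear z (a b : R) h k t :
  poisson_dkernel z (a%:C * h + b%:C * k) t =
  a%:C * poisson_dkernel z h t + b%:C * poisson_dkernel z k t.
Proof.
rewrite /poisson_dkernel /dlog_kernel.
have conjM (x y : R[i]) : Num.conj (x * y) = Num.conj x * Num.conj y := rmorphM _ x y.
have conjD (x y : R[i]) : Num.conj (x + y) = Num.conj x + Num.conj y := rmorphD _ x y.
have conjR (x : R) : Num.conj x%:C = x%:C := conjc_real x.
by rewrite !conjM !conjD !conjM !conjR; ring.
Qed.

(** The order of quantifiers matters: [A] is fixed before z, and [kap] before the direction h, so
    the final constant is uniform in both. *)
Lemma poisson_dkernel_majorant : exists2 A : R, 0 <= A & forall z, cabs z < 1 ->
  exists kap : R -> R, [/\ measurable_fun setT kap, forall t, 0 <= kap t,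
    forall t, kap t <= A / (1 - cabs z ^+ 2) ^+ 2,
    (\int[mu]_t (kap t)%:E <= (A / (1 - cabs z ^+ 2))%:E)%E &
    forall h t, cabs (poisson_dkernel z h t) <= kap t * cabs h].
Proof.
have p0 := pi_gt0 R.
pose B := expR ((`|Im alpha| + `|Im beta|) * (pi / 2)).
pose E := 2 * (cabs (alpha + beta + 1) + (cabs (alpha + 1) + cabs (beta + 1))).
pose C := cabs c * (B * E).
pose J := 8 * (2 `^ (s + 1) * (4 * 2 `^ s / s)) / (2 * pi).
have B0 : 0 <= B by exact: expR_ge0.
have E0 : 0 <= E by rewrite mulr_ge0// !addr_ge0 ?cabs_ge0.
have C0 : 0 <= C := mulr_ge0 (cabs_ge0 _) (mulr_ge0 B0 E0).
have J0 : 0 <= J.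
  by rewrite /J !(mulr_ge0, invr_ge0, powR_ge0) ?(ltW s0) ?(ltW p0).
(* The summand [2 ^ (s + 1)] serves the pointwise bound and [J * 2 ^ s] the integral; the powers of
   2 come from 1 - |z| >= D / 2. *)
exists (C * (2 `^ (s + 1) + J * 2 `^ s)).
  exact: mulr_ge0 C0 (addr_ge0 (powR_ge0 _ _) (mulr_ge0 J0 (powR_ge0 _ _))).
move=> z z1; have D0 := one_sub_cabs_sqr_gt0 z1.
set D := 1 - cabs z ^+ 2 in D0 *.
have d0 : 0 < 1 - cabs z by rewrite subr_gt0.
have dD : D / 2 <= 1 - cabs z by rewrite /D; have := cabs_ge0 z; nra.
have D20 : 0 < D / 2 by rewrite divr_gt0.
pose m := C * (D `^ s / D).
have m0 : 0 <= m := mulr_ge0 C0 (divr_ge0 (powR_ge0 _ _) (ltW D0)).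
have DsD x : D `^ s / (D / 2) `^ x = 2 `^ x * D `^ (s - x).
  have -> : (D / 2) `^ x = D `^ x / 2 `^ x.
    by rewrite powRM ?(ltW D0)// -powR_inv1// -powRrM mulN1r powRN.
  rewrite powRB ?(gt_eqF D0) ?implybT//.
  by field; rewrite !gt_eqF ?powR_gt0.
have kd0 t : 0 <= kernel_dist z t := cabs_ge0 _.
exists (fun t => m * kernel_dist z t `^ (- (s + 1))); split.
- apply: measurable_funM => //.
  by apply: measurableT_comp (measurable_powR _) (measurable_kernel_dist z).
- by move=> t; rewrite mulr_ge0 ?powR_ge0.
- move=> t; apply: (@le_trans _ _ (m * (D / 2) `^ (- (s + 1)))).
    rewrite ler_wpM2l// !powRN lef_pV2 ?posrE ?powR_gt0//; last first.
      exact: lt_le_trans (kernel_dist_ge z t).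
    apply: ge0_ler_powR; rewrite ?nnegrE ?(addr_ge0 (ltW s0) ler01) ?(ltW D20) ?kd0//.
    exact: le_trans dD (kernel_dist_ge z t).
  have -> : m * (D / 2) `^ (- (s + 1)) = C * 2 `^ (s + 1) / D ^+ 2.
    rewrite powRN (_ : m * _ = C * (D `^ s / (D / 2) `^ (s + 1)) / D);
      last by rewrite /m; ring.
    rewrite DsD (_ : s - (s + 1) = -1); last ring.
    by rewrite powR_inv1 ?(ltW D0)//; field; rewrite gt_eqF.
  rewrite ler_wpM2r ?invr_ge0 ?sqr_ge0// ler_wpM2l// lerDl.
  exact: mulr_ge0 J0 (powR_ge0 _ _).
- have kI := integral_kernel_le s0 z1; rewrite -/J in kI.
  under eq_integral do rewrite EFinM.
  rewrite ge0_integralZl//=; last 2 first.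
  + apply/measurable_EFinP.
    by apply: measurableT_comp (measurable_powR _) (measurable_kernel_dist z).
  + by move=> t _; rewrite lee_fin powR_ge0.
  apply: (le_trans (lee_wpmul2l _ kI)); first by rewrite lee_fin.
  rewrite -EFinM lee_fin.
  apply: (@le_trans _ _ (m * (J * (D / 2) `^ (- s)))).
    rewrite !ler_wpM2l// !powRN lef_pV2 ?posrE ?powR_gt0//.
    by apply: ge0_ler_powR; rewrite ?nnegrE ?(ltW s0) ?(ltW D20) ?(ltW d0).
  have -> : m * (J * (D / 2) `^ (- s)) = C * (J * (D `^ s / (D / 2) `^ s)) / D.
    by rewrite powRN /m; ring.
  rewrite DsD subrr powRr0 mulr1 ler_wpM2r ?invr_ge0 ?(ltW D0)// ler_wpM2l// lerDr powR_ge0//.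
- move=> h t; have zt : cabs (z * (expi t)^*) < 1 by rewrite cabs_rot.
  rewrite /poisson_dkernel (cabsM c) (cabsM (u_kernel _ _ _)).
  have hu := cabs_u_kernel_le alpha beta zt.
  have hd := cabs_dlog_kernel_le alpha beta (h * (expi t)^*) zt.
  rewrite !cabs_rot -/D -/(kernel_dist z t) -/B -/s in hu hd.
  rewrite (_ : m * _ * _ =
      cabs c * (B * (D `^ s * kernel_dist z t `^ (- (s + 1))) * (E * (cabs h / D)))).
    by rewrite ler_wpM2l ?cabs_ge0// ler_pM ?cabs_ge0.
  by rewrite /m /C; ring.
Qed.

Variables (f : R -> R[i]) (I : R).
Hypotheses (mf : cmeasurable f) (fI : (\int[mu]_t (cabs (f t))%:E <= I%:E)%E).

Let bounded_mul (k : R -> R[i]) (B : R) : cmeasurable k -> 0 <= B ->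
  (forall t, cabs (k t) <= B) ->
  cintegrable (fun t => k t * f t) /\
  cabs (cintegral mu setT (fun t => k t * f t)) <= 2 * (B * I).
Proof.
move=> mk B0 kB; have mF := cmeasurable_cabs mf.
apply: (@cintegral_cabs_le _ _ (fun t => B * cabs (f t))).
- exact: cmeasurableM.
- exact: measurable_funM.
- by move=> t; rewrite cabsM ler_wpM2r ?cabs_ge0.
- under eq_integral do rewrite EFinM.
  rewrite ge0_integralZl//=.
  + by rewrite EFinM lee_wpmul2l// lee_fin.
  + exact/measurable_EFinP.
  + by move=> t _; rewrite lee_fin cabs_ge0.
Qed.

Lemma cintegrable_poisson_kernel z : cabs z < 1 ->
  cintegrable (fun t => poisson_kernel z t * f t).
Proof.
move=> z1; have [M M0 uM] := cabs_u_kernel_bounded (cabs_ge0 z) z1 s0.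
apply: (proj1 (bounded_mul (cmeasurable_poisson_kernel z1) (_ : 0 <= cabs c * M) _)).
  by rewrite mulr_ge0 ?cabs_ge0.
by move=> t; rewrite cabsM ler_wpM2l ?cabs_ge0// uM// cabs_rot.
Qed.

Lemma cintegrable_poisson_dkernel z h : cabs z < 1 ->
  cintegrable (fun t => poisson_dkernel z h t * f t).
Proof.
move=> z1; have [A A0 /(_ z z1)[kap [_ _ kA _ dk]]] := poisson_dkernel_majorant.
apply: (proj1 (bounded_mul (cmeasurable_poisson_dkernel h z1)
  (_ : 0 <= A / (1 - cabs z ^+ 2) ^+ 2 * cabs h) _)).
  by rewrite mulr_ge0 ?cabs_ge0// divr_ge0// sqr_ge0.
by move=> t; rewrite (le_trans (dk h t))// ler_wpM2r ?cabs_ge0.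
Qed.

Let P z := cintegral mu setT (fun t => poisson_kernel z t * f t).
Let L z h := cintegral mu setT (fun t => poisson_dkernel z h t * f t).

Lemma poisson_derivative_linear z (a b : R) h k : cabs z < 1 ->
  L z (a%:C * h + b%:C * k) = a%:C * L z h + b%:C * L z k.
Proof.
move=> z1; have ih := cintegrable_poisson_dkernel h z1.
have ik := cintegrable_poisson_dkernel k z1.
rewrite /L -!cintegralZ// -cintegralD; [|exact: cintegrableZ..].
by congr cintegral; apply/funext => t; rewrite poisson_dkernel_linear; ring.
Qed.

(** All points z conj(zeta) have modulus |z|, so [u_kernel_taylor] with r = |z| holds with one
    constant on the whole circle and can be integrated against [f]. *)
Lemma poisson_expansion z : cabs z < 1 -> exists M, forall h,
  cabs h <= (1 - cabs z) / 2 -> cabs (P (z + h) - P z - L z h) <= M * cabs h ^+ 2.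
Proof.
move=> z1; have [M uM] := u_kernel_taylor (cabs_ge0 z) z1 s0.
exists (2 * (cabs c * `|M| * I)) => h hz.
have zh1 : cabs (z + h) < 1.
  by rewrite (le_lt_trans (cabsD _ _))//; have := cabs_ge0 h; lra.
have iz := cintegrable_poisson_kernel z1; have izh := cintegrable_poisson_kernel zh1.
have ih := cintegrable_poisson_dkernel h z1.
rewrite /P /L -!cintegralB//; last exact: cintegrableB.
pose k t := poisson_kernel (z + h) t - poisson_kernel z t - poisson_dkernel z h t.
rewrite (_ : (fun t => _) = fun t => k t * f t); last by apply/funext => t; rewrite /k; ring.
have mk : cmeasurable k.
  have [r1 i1] := cmeasurable_poisson_kernel zh1.
  have [r2 i2] := cmeasurable_poisson_kernel z1.
  have [r3 i3] := cmeasurable_poisson_dkernel h z1.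
  split; rewrite /k.
  - under eq_fun do rewrite !(ReD, ReN).
    by apply: measurable_funB => //; exact: measurable_funB.
  - under eq_fun do rewrite !(ImD, ImN).
    by apply: measurable_funB => //; exact: measurable_funB.
have kB t : cabs (k t) <= cabs c * `|M| * cabs h ^+ 2.
  have -> : k t = c * (u_kernel alpha beta (z * (expi t)^* + h * (expi t)^*)
      - u_kernel alpha beta (z * (expi t)^*)
      - u_kernel alpha beta (z * (expi t)^*) *
        dlog_kernel alpha beta (z * (expi t)^*) (h * (expi t)^*)).
    by rewrite /k /poisson_kernel /poisson_dkernel mulrDl; ring.
  rewrite cabsM -mulrA ler_wpM2l ?cabs_ge0//.
  have := uM (z * (expi t)^*) (h * (expi t)^*); rewrite !cabs_rot => /(_ (lexx _) hz).
  by move=> /le_trans; apply; rewrite ler_wpM2r ?sqr_ge0// ler_norm.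
have B0 : 0 <= cabs c * `|M| * cabs h ^+ 2 by rewrite !mulr_ge0 ?cabs_ge0 ?sqr_ge0.
have [_] := bounded_mul mk B0 kB; move/le_trans; apply.
by rewrite le_eqVlt; apply/orP; left; apply/eqP; ring.
Qed.

End poisson_derivative.

Theorem theorem3p5 (R : realType) (alpha beta : R[i]) (p : \bar R)
  (halpha : forall n : nat, alpha != - n.+1%:R)
  (hbeta : forall n : nat, beta != - n.+1%:R)
  (hRe : -1 < Re alpha + Re beta)
  (hp : (1 <= p)%E) :
  exists C : R, forall phi : R[i] -> R[i], circle_Lfun p phi ->
    forall z : R[i], cabs z < 1 ->
      real_differentiable (poisson_integral alpha beta phi) z /\
      real_diff_norm (poisson_integral alpha beta phi) z <=
        C * ((cabs (alpha + 1) + cabs (beta + 1)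
              + cabs (alpha * z) + cabs (beta * z))
             / (1 - cabs z ^+ 2) `^ (1 + fine (p^-1)%E))
          * fine (circle_Lnorm p phi).
Proof.
have [A A0 majorant] := poisson_dkernel_majorant hRe.
have alpha1 : 0 < cabs (alpha + 1).
  by apply: cabs_gt0; rewrite addr_eq0; exact: halpha 0%N.
have m0 : 0 < cabs (alpha + 1) + cabs (beta + 1) by rewrite ltr_wpDr ?cabs_ge0.
(* 4 is the 2 of [weighted_bound] times the 2 of [cintegral_cabs_le]. *)
exists (4 * A / (cabs (alpha + 1) + cabs (beta + 1))) => phi [mr mi Nphi] z z1.
pose f t := phi (expi t).
have mf : cmeasurable f by split.
have mF := cmeasurable_cabs mf.
have F0 t : 0 <= cabs (f t) by exact: cabs_ge0.
pose N := fine (circle_Lnorm p phi).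
have N0 : 0 <= N by rewrite fine_ge0// Lnorm_ge0.
have D0 := one_sub_cabs_sqr_gt0 z1.
(* The inclusion of L^p in L^1, as the case k = 1, A = D = 1 of [weighted_bound]. *)
have phi_L1 : (\int[angle_measure]_t (cabs (f t))%:E <= (2 * N)%:E)%E.
  have one_le (t : R) : cst 1 t <= 1 / 1 ^+ 2 :> R by rewrite expr1n divr1.
  have int_one : (\int[angle_measure]_t (cst (1 : R) t)%:E <= (1 / 1 : R)%:E)%E.
    by rewrite divr1 (integral_cst _ _ 1%:E)// mul1e; exact: probability_le1.
  have := weighted_bound (P := @angle_measure R) ler01 ltr01 mF F0
    (measurable_cst _) (fun=> ler01) one_le int_one hp Nphi.
  rewrite powR1 mulr1 divr1.
  by under eq_integral => t _ do rewrite [cst 1 t * _]mul1r.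
have [M expansion] := poisson_expansion hRe mf phi_L1 z1.
have eta0 : 0 < (1 - cabs z) / 2 by rewrite divr_gt0 ?subr_gt0.
(* The integral in [expansion] is [poisson_integral] up to unfolding. *)
have [dP dPE] := real_diff_of_expansion (f := poisson_integral alpha beta phi) eta0
  (fun a b h k => poisson_derivative_linear hRe mf phi_L1 a b h k z1) expansion.
split; first exact: dP.
have [kap [mkap kap0 kapA kapI dk]] := majorant z z1.
have kapN := weighted_bound (P := @angle_measure R) A0 D0 mF F0 mkap kap0 kapA kapI hp Nphi.
set Q := (1 - cabs z ^+ 2) `^ _ in kapN *.
have Q0 : 0 < Q by rewrite powR_gt0.
(* The set must be shown nonempty; h = 1 is a witness. *)
apply: ge_sup.
  exists (cabs (real_diff (poisson_integral alpha beta phi) z 1)).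
  by exists 1 => //; exact: cabs1.
move=> _ [h h1 <-]; rewrite dPE.
have dominated t : cabs (poisson_dkernel alpha beta z h t * f t) <= kap t * cabs (f t).
  by rewrite cabsM ler_wpM2r ?cabs_ge0// (le_trans (dk h t))// (h1 : cabs h = 1) mulr1.
have [_] := cintegral_cabs_le (cmeasurableM (cmeasurable_poisson_dkernel alpha beta h z1) mf)
  (measurable_funM mkap mF) dominated kapN.
move=> /le_trans; apply.
rewrite -/N mulrA ler_wpM2r// [leLHS](_ : _ = 4 * A / Q); last ring.
rewrite mulrA ler_wpM2r ?invr_ge0 ?(ltW Q0)//.
rewrite mulrAC ler_pdivlMr// ler_wpM2l ?mulr_ge0//.
by rewrite -addrA lerDl addr_ge0 ?cabs_ge0.
Qed.
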